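(* Let $a>0$ and $q>0$. Assume $u\in L^{3(q-1)/2}(\mathbb{R}^3)$ is a positive solution of $$u(x)=\int_{\mathbb{R}^3}\mathcal{K}_a(x-y)u^q(y)\,dy,\quad x\in\mathbb{R}^3.$$ Then: (i) $u\in L^s(\mathbb{R}^3)$ for every $s\in(3,\infty]$. Moreover, the left end point $3$ is optimal, i.e. $u\notin L^s(\mathbb{R}^3)$ for every $0<s\le 3$. (ii) $u$ is radially symmetric and decreasing about some point $x_0\in\mathbb{R}^3$. (iii) There exists a constant $C>1$ such that for all sufficiently large $|x|$, $$C^{-1}\mathcal{K}_a(x)\le u(x)\le C\,\mathcal{K}_a(x).$$
   Context: For $a>0$, $\mathcal{K}_a(x)=\frac{1-e^{-|x|/a}}{|x|}$ for $x\in\mathbb{R}^3\setminus\{0\}$. $u\in L^p(\mathbb{R}^3)$ (here $p=3(q-1)/2$) means $u$ is measurable and $\int_{\mathbb{R}^3}|u|^p\,dx<\infty$. *)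

(* Defs.v *)
From mathcomp Require Import all_boot all_order all_algebra.
From mathcomp Require Import all_classical all_reals all_analysis.
From mathcomp Require Import measurable_realfun ess_sup_inf.

Set Implicit Arguments.
Unset Strict Implicit.
Unset Printing Implicit Defensive.

Import Order.TTheory GRing.Theory Num.Theory.
Import numFieldNormedType.Exports.

Local Open Scope classical_set_scope.
Local Open Scope ring_scope.

Notation space3 R := (R * R * R)%type.

(* The measure of a Borel set of R^3; Lebesgue null sets are its
   [negligible] sets. *)
Notation volume3 R :=
  (((@lebesgue_measure R) \x (@lebesgue_measure R))
     \x (@lebesgue_measure R))%E.

(* The library norm [`|x|] on a product type is the sup norm, hence this. *)
Definition enorm (R : realType) (x : space3 R) : R :=
  Num.sqrt (x.1.1 ^+ 2 + x.1.2 ^+ 2 + x.2 ^+ 2).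

(* The value at the origin, where the formula is undefined, is 0
   because 0^-1 = 0; it has no influence on integrals. *)
Definition bp_kernel (R : realType) (a : R) (x : space3 R) : R :=
  (1 - expR (- (enorm x / a))) / enorm x.

(* Measurability with respect to the Lebesgue (completed Borel)
   sigma-algebra; [measurable_fun] alone would mean Borel measurability. *)
Definition lebesgue_measurable3 (R : realType) (u : space3 R -> R) : Prop :=
  forall B : set R, measurable B -> completed_algebra_gen (volume3 R) (u @^-1` B).

(* For a nonnegative f, [\int[mu]_x f x] is the supremum of the integrals of the
   Borel simple functions below f; when f is only Lebesgue measurable, this is
   still its integral against the completed measure.
   A finite exponent is an arbitrary real number, only the finiteness of the
   integral of |u|^r being required. When r < 0 this is meant for functions
   without zeros, since [0 `^ r = 0]. *)
Definition memLp3 (R : realType) (p : \bar R) (u : space3 R -> R) : Prop :=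
  lebesgue_measurable3 u /\
  match p with
  | r%:E => (\int[volume3 R]_x (`|u x| `^ r)%:E < +oo)%E
  | +oo%E => (ess_sup (volume3 R) (fun x => `|u x|%:E) < +oo)%E
  | -oo%E => False
  end.

Definition is_positive_solution (R : realType) (a q : R)
    (u : space3 R -> R) : Prop :=
  (forall x, 0 < u x) /\
  (forall x, (u x)%:E =
     (\int[volume3 R]_y (bp_kernel a (x - y) * u y `^ q)%:E)%E).

(* Decreasing is understood strictly. *)
Definition radially_decreasing_about (R : realType) (x0 : space3 R)
    (u : space3 R -> R) : Prop :=
  (forall x y, enorm (x - x0) = enorm (y - x0) -> u x = u y) /\
  (forall x y, enorm (x - x0) < enorm (y - x0) -> u y < u x).

(* Main.v *)
From HB Require Import structures.
Require Import Defs.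
From mathcomp Require Import all_boot all_order all_algebra.
From mathcomp Require Import all_classical all_reals all_analysis.
From mathcomp Require Import measurable_realfun ess_sup_inf.
From mathcomp Require Import ring lra.
Set Implicit Arguments.
Unset Strict Implicit.
Unset Printing Implicit Defensive.
Import Order.TTheory GRing.Theory Num.Theory.
Import numFieldNormedType.Exports.
Local Open Scope classical_set_scope.
Local Open Scope ring_scope.

(** Why the theorem holds.  The function [K(x) = (1 - exp (- |x| / a)) / |x|]
    lies between [1 / (a + |x|)] and [2 / (a + |x|)], is strictly decreasing in
    [|x|], and changes by a factor of at most [exp (d / a)] when its argument
    moves by [d] ([kern_harnack]).  The last property passes under the integral
    sign: [u x <= exp (|x - x'| / a) * u x'] ([solution_harnack]).  So [u] is
    continuous, and its value at a point is controlled by its mean over the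
    unit ball; as [u^p] is integrable with [p = 3 (q - 1) / 2], [u] is bounded
    and vanishes at infinity as soon as [p > 0].  The case [p <= 0] is empty:
    there [1 <= u^q + u^p], and integrating against [K] would make [K]
    integrable.

    Decay.  The exponent [p] is the one for which the mass of [u^p] on a ball of
    radius [u x ^ (- (q - 1) / 2)] around [x] does not see the size of [u x].
    At a point selected so that [u] is comparable to [u x] on such a ball, the
    part of the integral over a small multiple of the ball is at most half of
    [u x]; the remaining part varies on this small ball by a factor of at most
    [4], hence [u >= u x / 8] there and the ball carries a fixed mass of [u^p].
    Far from the origin this is impossible, so [u x ^ ((q - 1) / 2) * |x|] tends
    to [0] ([solution_critical_decay]).  Compared with the trivial lower bound
    [u x >= c / (a + |x|)] this forces [q > 3].  It also says that the potential
    [u^(q-1)] in the linear equation [u = K * (u^(q-1) u)] is [o(|x|^-2)], and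
    on weights [|x|^-b] with [0 < b < 1] the kernel against [|x|^-2] is bounded
    ([riesz_estimate]); an absorption argument gives [u <= C |x|^-b] for every
    [b < 1] ([solution_decay_powR]).  For [b] close to [1] the function [u^q] is
    integrable, and then [u <= C / (a + |x|)] ([solution_upper]).  The two-sided
    bound by [1 / (a + |x|)] gives (i), the endpoint [3] being that of
    [|x|^-3], and (iii).

    Symmetry.  Moving planes in the direction of the first axis: if [u] exceeds
    its reflection on a part of a half-space, the largest excess [S] is at most
    [S] times a quantity controlled by the integral of [u^q] over that part, so
    a bad set of small mass is empty ([dominated_small]).  This starts the
    procedure far away, and together with dominated convergence it shows that
    the procedure stops only at a plane of symmetry
    ([exists_symmetry_plane]).  The equation is invariant under isometries, and
    rotations preserve the volume because they are products of shears, so the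
    same holds in every direction.  Planes orthogonal to the axes give a center,
    all symmetry planes contain it (two parallel ones would make [u] periodic),
    and (ii) follows ([decaying_radial]). *)

(** * Borel functions on the space and their integrals *)

Notation mspace R :=
  (measurableTypeR R * measurableTypeR R * measurableTypeR R)%type.

Section Borel.
Context {R : realType}.
Implicit Types (f g : space3 R -> R) (b : space3 R -> bool)
  (T : space3 R -> space3 R).

Definition borel3 f := measurable_fun [set: mspace R] (f : mspace R -> R).
Definition borelp b := measurable_fun [set: mspace R] (b : mspace R -> bool).
Definition borelm T :=
  [/\ borel3 (fun x => (T x).1.1), borel3 (fun x => (T x).1.2)
    & borel3 (fun x => (T x).2)].

Lemma borel3_cst (c : R) : borel3 (fun=> c).
Proof. exact: measurable_cst. Qed.

Lemma borel3_x1 : borel3 (fun x => x.1.1).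
Proof. by apply: (measurableT_comp measurable_fst); exact: measurable_fst. Qed.

Lemma borel3_x2 : borel3 (fun x => x.1.2).
Proof. by apply: (measurableT_comp measurable_snd); exact: measurable_fst. Qed.

Lemma borel3_x3 : borel3 (fun x => x.2).
Proof. exact: measurable_snd. Qed.

Lemma borel3D f g : borel3 f -> borel3 g -> borel3 (fun x => f x + g x).
Proof. exact: measurable_funD. Qed.

Lemma borel3B f g : borel3 f -> borel3 g -> borel3 (fun x => f x - g x).
Proof. exact: measurable_funB. Qed.

Lemma borel3M f g : borel3 f -> borel3 g -> borel3 (fun x => f x * g x).
Proof. exact: measurable_funM. Qed.

Lemma borel3N f : borel3 f -> borel3 (fun x => - f x).
Proof. by move=> mf; exact: measurableT_comp. Qed.

Lemma borel3X f n : borel3 f -> borel3 (fun x => f x ^+ n).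
Proof. exact: measurable_funX. Qed.

Lemma borel3_powR f p : borel3 f -> borel3 (fun x => f x `^ p).
Proof. by move=> mf; exact: (measurableT_comp (measurable_powR p) mf). Qed.

Lemma borel3_noninc f (k : R -> R) : {homo k : s t /~ t <= s} ->
  borel3 f -> borel3 (fun x => k (f x)).
Proof.
move=> kni mf.
by apply: (measurableT_comp (nonincreasing_measurable measurableT kni) mf).
Qed.

Lemma borel3_sqrt f : borel3 f -> borel3 (fun x => Num.sqrt (f x)).
Proof.
by move=> mf;
  exact: (measurableT_comp (continuous_measurable_fun (@sqrt_continuous R)) mf).
Qed.

Lemma borelp_lt f g : borel3 f -> borel3 g -> borelp (fun x => f x < g x).
Proof. exact: measurable_fun_ltr. Qed.

Lemma borelp_le f g : borel3 f -> borel3 g -> borelp (fun x => f x <= g x).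
Proof. exact: measurable_fun_ler. Qed.

Lemma borelp_and b b' : borelp b -> borelp b' -> borelp (fun x => b x && b' x).
Proof. exact: measurable_and. Qed.

Lemma borel3_if b f g : borelp b -> borel3 f -> borel3 g ->
  borel3 (fun x => if b x then f x else g x).
Proof. exact: measurable_fun_ifT. Qed.

Lemma borel3_comp f T : borel3 f -> borelm T -> borel3 (fun x => f (T x)).
Proof.
move=> mf [m1 m2 m3].
have mT : measurable_fun [set: mspace R] (T : mspace R -> mspace R).
  rewrite (_ : T = fun x => ((T x).1.1, (T x).1.2, (T x).2)).
    by do 2?[apply: measurable_fun_pair].
  by apply/funext => x; case: (T x) => [[]].
exact: (measurableT_comp mf mT).
Qed.

Lemma borelm_comp T T' : borelm T -> borelm T' -> borelm (fun x => T (T' x)).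
Proof.
move=> [m1 m2 m3] mT'; split.
- exact: (borel3_comp m1 mT').
- exact: (borel3_comp m2 mT').
- exact: (borel3_comp m3 mT').
Qed.

Lemma borel3_enorm : borel3 (@enorm R).
Proof.
apply: borel3_sqrt; apply: borel3D; first apply: borel3D;
  apply: borel3X; [exact: borel3_x1|exact: borel3_x2|exact: borel3_x3].
Qed.

Lemma borelm_subr c : borelm (fun y => c - y).
Proof.
split; apply: borel3B; by [exact: borel3_cst|exact: borel3_x1
  |exact: borel3_x2|exact: borel3_x3].
Qed.

Definition int3 f : \bar R := (\int[volume3 R]_y (f y)%:E)%E.

Lemma int3E f : int3 f = (\int[volume3 R]_y (f y)%:E)%E.
Proof. by []. Qed.

Lemma int3_ge0 f : (forall x, 0 <= f x) -> (0 <= int3 f)%E.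
Proof. by move=> f0; apply: integral_ge0 => x _; rewrite lee_fin. Qed.

(** The integral of a nonnegative function is a supremum over the simple
    functions below it, so that monotonicity holds without measurability. *)
Lemma integral_mono (f g : space3 R -> \bar R) : (forall x, 0 <= f x)%E ->
  (forall x, f x <= g x)%E ->
  (\int[volume3 R]_x f x <= \int[volume3 R]_x g x)%E.
Proof.
move=> f0 fg; rewrite !ge0_integralTE//.
  apply: ereal_sup_le => _ [h /= hf <-]; exists h => // x.
  exact: le_trans (hf x) _.
by move=> x; exact: le_trans (fg x).
Qed.

Lemma int3_le f g : (forall x, 0 <= f x) -> (forall x, f x <= g x) ->
  (int3 f <= int3 g)%E.
Proof. by move=> f0 fg; apply: integral_mono => x; rewrite lee_fin. Qed.

Lemma eq_int3 f g : (forall x, f x = g x) -> int3 f = int3 g.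
Proof. by move=> fg; congr int3; apply/funext. Qed.

Lemma int3D f g : borel3 f -> borel3 g -> (forall x, 0 <= f x) ->
  (forall x, 0 <= g x) -> int3 (fun x => f x + g x) = (int3 f + int3 g)%E.
Proof.
move=> mf mg f0 g0; rewrite /int3.
under eq_integral do rewrite EFinD.
rewrite ge0_integralD//.
- by move=> x _; rewrite lee_fin.
- exact/measurable_EFinP.
- by move=> x _; rewrite lee_fin.
- exact/measurable_EFinP.
Qed.

Lemma int3Z c f : borel3 f -> 0 <= c -> (forall x, 0 <= f x) ->
  int3 (fun x => c * f x) = (c%:E * int3 f)%E.
Proof.
move=> mf c0 f0; rewrite /int3.
under eq_integral do rewrite EFinM.
rewrite ge0_integralZl_EFin//.
- by move=> x _; rewrite lee_fin.
- exact/measurable_EFinP.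
Qed.

End Borel.

(* Comparing two integrals must not unfold their definition. *)
Global Opaque int3.

(** Borel measurability of an expression, read off its syntax. *)
Ltac bor :=
  lazymatch goal with
  | |- borel3 (fun=> ?c) => exact: borel3_cst
  | |- borel3 (fun x => x.1.1) => exact: borel3_x1
  | |- borel3 (fun x => x.1.2) => exact: borel3_x2
  | |- borel3 (fun x => x.2) => exact: borel3_x3
  | |- borel3 snd => exact: borel3_x3
  | |- borel3 (@enorm _) => exact: borel3_enorm
  | |- borel3 (fun x => if _ then _ else _) => apply: borel3_if; bor
  | |- borel3 (fun x => _ + - _) => apply: borel3B; bor
  | |- borel3 (fun x => _ + _) => apply: borel3D; bor
  | |- borel3 (fun x => - _) => apply: borel3N; bor
  | |- borel3 (fun x => _ * _) => apply: borel3M; bor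
  | |- borel3 (fun x => _ ^+ _) => apply: borel3X; bor
  | |- borel3 (fun x => _ `^ _) => apply: borel3_powR; bor
  | |- borel3 (fun x => enorm (_ - x)) =>
      exact: (borel3_comp borel3_enorm (borelm_subr _))
  | |- borel3 (fun x => enorm x) => exact: borel3_enorm
  | |- borelp (fun x => _ && _) => apply: borelp_and; bor
  | |- borelp (fun x => _ < _) => apply: borelp_lt; bor
  | |- borelp (fun x => _ <= _) => apply: borelp_le; bor
  | |- _ => try assumption
  end.

(** * Volume-preserving maps *)

Section Area.
Context {R : realType}.
Local Notation M := (measurableTypeR R).
Local Notation leb := (@lebesgue_measure R).

(** The planar measure gets a name so that its sigma-finiteness can be attached
    to it; [volume3] is convertible to [area \x lebesgue_measure]. *)
Definition area : set (M * M)%type -> \bar R := (leb \x leb)%E.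

HB.instance Definition _ := Measure.on area.

Lemma area_sigma_finite : sigma_finite setT area.
Proof.
have /sigma_finiteP[F [TF ndF Foo]] := sigma_finiteT leb.
exists (fun n => F n `*` F n).
 rewrite -setXTT {1}TF TF predeqE => -[x y]; split.
    move=> [/= [n _ Fnx] [k _ Gky]]; exists (maxn n k) => //; split.
    - by move: x Fnx; exact/subsetPset/ndF/leq_maxl.
    - by move: y Gky; exact/subsetPset/ndF/leq_maxr.
  by move=> [n _ []/= ? ?]; split; exists n.
move=> k; have [? ?] := Foo k.
split; first exact: measurableX.
by rewrite /area/= product_measure1E// lte_mul_pinfty// ge0_fin_numE.
Qed.

HB.instance Definition _ :=
  Measure_isSigmaFinite.Build _ _ _ area area_sigma_finite.

Lemma integral_shift (g : M -> \bar R) (c : R) :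
  measurable_fun setT g -> (forall t, 0 <= g t)%E ->
  (\int[leb]_t g (t + c)%R = \int[leb]_t g t)%E.
Proof.
move=> mg g0.
have mphi : measurable_fun [set: M] ((fun t => t + c) : M -> M).
  by apply: measurable_funD => //; exact: measurable_cst.
have E : forall A : set M, measurable A ->
    pushforward leb ((fun t => t + c) : M -> M) A = leb A.
  move=> A mA; apply/esym/lebesgue_measure_unique => //= _ [[a b]] _ <- /=.
  rewrite /pushforward (_ : _ @^-1` _ = `]a - c, b - c]%classic); last first.
    by apply/seteqP; split => t /=; rewrite !in_itv/= ltrBlDr lerBrDr.
  rewrite !lebesgue_measure_itv/= !lte_fin.
  by rewrite ltrD2r; case: ifP => // _; rewrite -!EFinB; congr (_%:E); ring.
have := ge0_integral_pushforward mphi leb measurableT mg (fun t _ => g0 t).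
rewrite preimage_setT => <-.
by apply: eq_measure_integral => A mA _; exact: E.
Qed.

Lemma integral_opp (g : M -> \bar R) :
  measurable_fun setT g -> (forall t, 0 <= g t)%E ->
  (\int[leb]_t g (- t)%R = \int[leb]_t g t)%E.
Proof.
move=> mg g0.
have mphi : measurable_fun [set: M] (-%R : M -> M) by exact: oppr_measurable.
have := ge0_integral_pushforward mphi leb measurableT mg (fun t _ => g0 t).
rewrite preimage_setT => <-.
by apply: eq_measure_integral => A mA _; exact: lebesgue_measureN.
Qed.

End Area.

Section Preserve.
Context {R : realType}.
Local Notation M := (measurableTypeR R).
Local Notation leb := (@lebesgue_measure R).
Implicit Types (f : space3 R -> R) (T : space3 R -> space3 R).

(** Stated for integrals of nonnegative functions, the form of every change of
    variables below. *)
Definition volpres T := borelm T /\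
  forall f, borel3 f -> (forall x, 0 <= f x) ->
    int3 (fun x => f (T x)) = int3 f.

Lemma volpres_comp T T' : volpres T -> volpres T' ->
  volpres (fun x => T (T' x)).
Proof.
move=> [mT pT] [mT' pT']; split; first exact: borelm_comp.
move=> f mf f0; rewrite -[RHS]pT//.
by apply: (pT' (fun x => f (T x))) => //; exact: borel3_comp.
Qed.

Lemma int3_area f : borel3 f -> (forall x, 0 <= f x) ->
  int3 f = (\int[area]_p \int[leb]_z (f (p, z))%:E)%E.
Proof.
move=> mf f0; rewrite int3E.
rewrite (@fubini_tonelli1 _ _ _ _ _ area leb (fun x => (f x)%:E))//.
exact/measurable_EFinP.
Qed.

Lemma measurable_area f : borel3 f -> (forall x, 0 <= f x) ->
  measurable_fun [set: (M * M)%type] (fun p => \int[leb]_z (f (p, z))%:E)%E.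
Proof.
move=> mf f0.
apply: (@measurable_fun_fubini_tonelli_F _ _ _ _ _ leb
  (fun x => (f x)%:E)) => //.
exact/measurable_EFinP.
Qed.

Lemma int3_iter f : borel3 f -> (forall x, 0 <= f x) ->
  int3 f = (\int[leb]_x \int[leb]_y \int[leb]_z (f (x, y, z))%:E)%E.
Proof.
move=> mf f0; rewrite int3_area// /area fubini_tonelli1//.
- exact: measurable_area.
- by move=> p; apply: integral_ge0 => z _; rewrite lee_fin.
Qed.

(** Tonelli's theorem in the first two variables; all other coordinate changes
    reduce to maps of the last coordinate by such permutations. *)
Lemma volpres_swap12 : volpres (fun x => (x.1.2, x.1.1, x.2)).
Proof.
have mT : borelm (fun x : space3 R => (x.1.2, x.1.1, x.2)).
  by split; rewrite /=; bor.
split; first exact: mT.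
move=> f mf f0; rewrite (int3_iter mf f0) (int3_iter (borel3_comp mf mT) (fun x => f0 _))/=.
have G0 (p : (M * M)%type) : (0 <= \int[leb]_z (f (p, z))%:E)%E.
  by apply: integral_ge0 => z _; rewrite lee_fin.
have /= E := @fubini_tonelli _ _ _ _ _ leb leb
  (fun p => \int[leb]_z (f (p, z))%:E)%E (measurable_area mf f0) G0.
exact/esym.
Qed.

Lemma volpres_swap23 : volpres (fun x => (x.1.1, x.2, x.1.2)).
Proof.
have mT : borelm (fun x : space3 R => (x.1.1, x.2, x.1.2)).
  by split; rewrite /=; bor.
split; first exact: mT.
move=> f mf f0; rewrite (int3_iter mf f0) (int3_iter (borel3_comp mf mT) (fun x => f0 _))/=.
apply: eq_integral => x _.
rewrite (@fubini_tonelli _ _ _ _ _ leb leb (fun p => (f (x, p.1, p.2))%:E));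
  [by []| |by move=> p; rewrite lee_fin].
apply/measurable_EFinP.
apply: (measurableT_comp mf).
apply: measurable_fun_pair; last exact: measurable_snd.
by apply: measurable_fun_pair; [exact: measurable_cst|exact: measurable_fst].
Qed.

(** On each vertical line the shear is a translation. *)
Lemma volpres_shear3 (h : space3 R -> R) :
  borel3 (fun x => h (x.1, 0)) ->
  volpres (fun x => (x.1, x.2 + h (x.1, 0))).
Proof.
move=> mh.
have mT : borelm (fun x : space3 R => (x.1, x.2 + h (x.1, 0))).
  by split; rewrite /=; bor.
split; first exact: mT.
move=> f mf f0; rewrite (int3_area mf f0) (int3_area (borel3_comp mf mT) (fun x => f0 _))/=.
apply: eq_integral => p _.
rewrite (@integral_shift _ (fun z => (f (p, z))%:E));
  [by []| |by move=> z; rewrite lee_fin].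
apply/measurable_EFinP; apply: (measurableT_comp mf).
by apply: measurable_fun_pair; first exact: measurable_cst.
Qed.

Lemma volpres_flip3 : volpres (fun x => (x.1, - x.2)).
Proof.
have mT : borelm (fun x : space3 R => (x.1, - x.2)) by split; rewrite /=; bor.
split; first exact: mT.
move=> f mf f0; rewrite (int3_area mf f0) (int3_area (borel3_comp mf mT) (fun x => f0 _))/=.
apply: eq_integral => p _.
rewrite (@integral_opp _ (fun z => (f (p, z))%:E));
  [by []| |by move=> z; rewrite lee_fin].
apply/measurable_EFinP; apply: (measurableT_comp mf).
by apply: measurable_fun_pair; first exact: measurable_cst.
Qed.

End Preserve.

Section Isometries.
Context {R : realType}.
Implicit Types (f : space3 R -> R) (T : space3 R -> space3 R).

Lemma volpres_ext T T' : (forall x, T x = T' x) -> volpres T -> volpres T'.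
Proof. by move=> /funext ->. Qed.

Lemma volpres_swap13 : volpres (fun x : space3 R => (x.2, x.1.2, x.1.1)).
Proof.
apply: volpres_ext (volpres_comp volpres_swap12
  (volpres_comp volpres_swap23 volpres_swap12)) => x //.
Qed.

Lemma volpres_shear1 (s t c : R) :
  volpres (fun x => (x.1.1 + (s * x.1.2 + t * x.2 + c), x.1.2, x.2)).
Proof.
pose h (x : space3 R) := s * x.1.2 + t * x.1.1 + c.
have mh : borel3 (fun x => h (x.1, 0)) by rewrite /h /=; bor.
exact: volpres_ext (volpres_comp volpres_swap13
  (volpres_comp (volpres_shear3 mh) volpres_swap13)).
Qed.

Lemma volpres_shear2 (s t c : R) :
  volpres (fun x => (x.1.1, x.1.2 + (s * x.1.1 + t * x.2 + c), x.2)).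
Proof.
pose h (x : space3 R) := s * x.1.1 + t * x.1.2 + c.
have mh : borel3 (fun x => h (x.1, 0)) by rewrite /h /=; bor.
exact: volpres_ext (volpres_comp volpres_swap23
  (volpres_comp (volpres_shear3 mh) volpres_swap23)).
Qed.

Lemma volpres_shear3_lin (s t c : R) :
  volpres (fun x => (x.1, x.2 + (s * x.1.1 + t * x.1.2 + c))).
Proof.
pose h (x : space3 R) := s * x.1.1 + t * x.1.2 + c.
have mh : borel3 (fun x => h (x.1, 0)) by rewrite /h /=; bor.
exact: volpres_shear3 mh.
Qed.

Lemma volpres_flip1 : volpres (fun x : space3 R => (- x.1.1, x.1.2, x.2)).
Proof.
exact: volpres_ext (volpres_comp volpres_swap13
  (volpres_comp volpres_flip3 volpres_swap13)).
Qed.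

Lemma volpres_flip2 : volpres (fun x : space3 R => (x.1.1, - x.1.2, x.2)).
Proof.
exact: volpres_ext (volpres_comp volpres_swap23
  (volpres_comp volpres_flip3 volpres_swap23)).
Qed.

Lemma volpres_addl (c : space3 R) : volpres (fun x => c + x).
Proof.
apply: volpres_ext (volpres_comp (volpres_shear1 0 0 c.1.1)
  (volpres_comp (volpres_shear2 0 0 c.1.2) (volpres_shear3_lin 0 0 c.2))).
by move=> [[x y] z]; case: c => [[c1 c2] c3] /=;
  congr (_, _, _); rewrite /=; ring.
Qed.

Lemma volpres_subl (c : space3 R) : volpres (fun x => c - x).
Proof.
apply: volpres_ext (volpres_comp (volpres_addl c) (volpres_comp volpres_flip1
  (volpres_comp volpres_flip2 volpres_flip3))).
by move=> [[x y] z].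
Qed.

(** With [t = tan (theta / 2) = s / (1 + c)], the rotation of angle [theta] is
    the product of the shears of slopes [- t], [s] and [- t]. *)
Lemma volpres_rot12 (c s : R) : c ^+ 2 + s ^+ 2 = 1 ->
  volpres (fun x => (c * x.1.1 - s * x.1.2, s * x.1.1 + c * x.1.2, x.2)).
Proof.
move=> cs; have [c1|c1] := eqVneq (1 + c) 0.
  have c1' : c = -1 by lra.
  have s0 : s = 0 by apply/eqP; rewrite -sqrf_eq0; apply/eqP; nra.
  apply: volpres_ext (volpres_comp volpres_flip1 volpres_flip2).
  by move=> [[x y] z]; rewrite /= c1' s0; congr (_, _, _); ring.
set t := s / (1 + c).
apply: volpres_ext (volpres_comp (volpres_shear1 (- t) 0 0)
  (volpres_comp (volpres_shear2 s 0 0) (volpres_shear1 (- t) 0 0))).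
have st : s * t = 1 - c.
  by apply: (mulIf c1); rewrite /t mulrA mulfVK//; lra.
have ct : t * c = s - t by rewrite -[s in RHS](mulfVK c1) -/t; ring.
have st0 : 1 - c - s * t = 0 by rewrite st; ring.
have ct0 : s - t - t * c = 0 by rewrite ct; ring.
move=> [[x y] z] /=; congr (_, _, _).
- transitivity (c * x - s * y + (1 - c - s * t) * (x - t * y)
    + (s - t - t * c) * y); first by ring.
  by rewrite st0 ct0; ring.
- transitivity (s * x + c * y + (1 - c - s * t) * y); first by ring.
  by rewrite st0; ring.
Qed.

Lemma volpres_rot13 (c s : R) : c ^+ 2 + s ^+ 2 = 1 ->
  volpres (fun x => (c * x.1.1 - s * x.2, x.1.2, s * x.1.1 + c * x.2)).
Proof.
move=> cs; exact: volpres_ext (volpres_comp volpres_swap23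
  (volpres_comp (volpres_rot12 cs) volpres_swap23)).
Qed.

End Isometries.

(** * Volumes *)

Section Volumes.
Context {R : realType}.
Implicit Types (f : space3 R -> R) (c x z : space3 R).

Definition cubep c (r : R) z :=
  [&& c.1.1 <= z.1.1, z.1.1 < c.1.1 + r, c.1.2 <= z.1.2, z.1.2 < c.1.2 + r,
      c.2 <= z.2 & z.2 < c.2 + r].

Lemma borelp_cube c r : borelp (cubep c r).
Proof. by rewrite /cubep; bor. Qed.

Lemma int3_cube c r : 0 <= r ->
  int3 (fun z => if cubep c r z then 1 else 0) = (r ^+ 3)%:E.
Proof.
move=> r0.
pose I (a : R) := [set` `[a, a + r[%R] : set (measurableTypeR R).
have vI a : lebesgue_measure (I a) = r%:E.
  rewrite /I lebesgue_measure_itv/= lte_fin; case: ifPn => h.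
    by rewrite -EFinB; congr EFin; ring.
  by congr EFin; lra.
have mI a : measurable (I a) by exact: measurable_itv.
pose B : set (mspace R) := I c.1.1 `*` I c.1.2 `*` I c.2.
rewrite (eq_int3 (g := \1_B)); last first.
  move=> z; rewrite indicE; case: ifPn => [/andP[h1 /and5P[h2 h3 h4 h5 h6]]|h].
    by rewrite mem_set//; do 2?split; rewrite /I/= in_itv/=; apply/andP.
  rewrite memNset// => -[[]]; rewrite /I/= !in_itv/=.
  move=> /andP[h1 h2] /andP[h3 h4] /andP[h5 h6].
  by move/negP: h; apply; apply/andP; split=> //; apply/and5P.
rewrite int3E integral_indic//; last by do 2?apply: measurableX.
rewrite setIT.
transitivity (area (I c.1.1 `*` I c.1.2) * lebesgue_measure (I c.2))%E.
  by apply: (product_measure1E area) => //; exact: measurableX.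
transitivity (lebesgue_measure (I c.1.1) * lebesgue_measure (I c.1.2)
    * lebesgue_measure (I c.2))%E.
  by congr (_ * _)%E; exact: product_measure1E.
by rewrite !vI -!EFinM; congr EFin; ring.
Qed.

End Volumes.


(** * Euclidean norm, balls and dyadic shells *)

Section Enorm.
Context {R : realType}.
Implicit Types x y z : space3 R.

Lemma enorm_sqr x : enorm x ^+ 2 = x.1.1 ^+ 2 + x.1.2 ^+ 2 + x.2 ^+ 2.
Proof. by rewrite sqr_sqrtr// !addr_ge0// sqr_ge0. Qed.

Lemma enorm_ge0 x : 0 <= enorm x.
Proof. exact: sqrtr_ge0. Qed.

Lemma enorm_le x r : 0 <= r ->
  x.1.1 ^+ 2 + x.1.2 ^+ 2 + x.2 ^+ 2 <= r ^+ 2 -> enorm x <= r.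
Proof.
by move=> r0 h; rewrite -(@ler_pXn2r _ 2)// ?nnegrE ?enorm_ge0// enorm_sqr.
Qed.

Lemma enorm_lt x r : 0 <= r ->
  x.1.1 ^+ 2 + x.1.2 ^+ 2 + x.2 ^+ 2 < r ^+ 2 -> enorm x < r.
Proof.
by move=> r0 h; rewrite -(@ltr_pXn2r _ 2)// ?nnegrE ?enorm_ge0// enorm_sqr.
Qed.

Lemma eq_enorm x y : x.1.1 ^+ 2 + x.1.2 ^+ 2 + x.2 ^+ 2 =
  y.1.1 ^+ 2 + y.1.2 ^+ 2 + y.2 ^+ 2 -> enorm x = enorm y.
Proof. by rewrite /enorm => ->. Qed.

Lemma enorm_coord x : [/\ `|x.1.1| <= enorm x, `|x.1.2| <= enorm x
  & `|x.2| <= enorm x].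
Proof.
split; rewrite -(@ler_pXn2r _ 2)// ?nnegrE ?enorm_ge0// enorm_sqr real_normK
  ?num_real//; nra.
Qed.

Lemma enormN x : enorm (- x) = enorm x.
Proof. by apply: eq_enorm => /=; rewrite !sqrrN. Qed.

Lemma enormC x y : enorm (x - y) = enorm (y - x).
Proof. by rewrite -enormN opprB. Qed.

Lemma enormD x y : enorm (x + y) <= enorm x + enorm y.
Proof.
apply: enorm_le; first by rewrite addr_ge0// enorm_ge0.
case: x => [[x1 x2] x3]; case: y => [[y1 y2] y3].
set s := enorm _; set t := enorm _.
have s0 : 0 <= s := enorm_ge0 _.
have t0 : 0 <= t := enorm_ge0 _.
have := enorm_sqr (x1, x2, x3); have := enorm_sqr (y1, y2, y3).
rewrite -/s -/t /= => tE sE.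
have : x1 * y1 + x2 * y2 + x3 * y3 <= s * t.
  have [|h] := leP (x1 * y1 + x2 * y2 + x3 * y3) 0.
    by move=> /le_trans; apply; exact: mulr_ge0.
  rewrite -(@ler_pXn2r _ 2)// ?nnegrE ?mulr_ge0// ?(ltW h)// exprMn sE tE.
  have := sqr_ge0 (x1 * y2 - x2 * y1); have := sqr_ge0 (x1 * y3 - x3 * y1).
  have := sqr_ge0 (x2 * y3 - x3 * y2); nra.
nra.
Qed.

Lemma enorm_triangle x y z : enorm (x - z) <= enorm (x - y) + enorm (y - z).
Proof. by apply: le_trans (enormD _ _); rewrite addrA subrK. Qed.

Lemma enorm0 : enorm (0 : space3 R) = 0.
Proof. by rewrite /enorm /= expr0n /= !addr0 sqrtr0. Qed.

Lemma enorm_eq0 x : enorm x = 0 -> x = 0.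
Proof.
have [h1 h2 h3] := enorm_coord x => h.
move: h1 h2 h3; rewrite h !normr_le0 => /eqP h1 /eqP h2 /eqP h3.
by case: x h h1 h2 h3 => [[? ?] ?] _ /= -> -> ->.
Qed.

Lemma enorm_gt0 x : x != 0 -> 0 < enorm x.
Proof.
move=> x0; rewrite lt_neqAle enorm_ge0 andbT eq_sym.
by apply: contra x0 => /eqP /enorm_eq0 ->.
Qed.

End Enorm.

Section Balls.
Context {R : realType}.
Implicit Types (f : space3 R -> R) (x z : space3 R).

Definition ballp x (r : R) z := enorm (x - z) < r.

Lemma borelp_ball x r : borelp (ballp x r).
Proof. by rewrite /ballp; bor. Qed.

Lemma int3_ball_le x r : 0 <= r ->
  (int3 (fun z => (if ballp x r z then 1 else 0)%R) <= (8 * r ^+ 3)%:E)%E.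
Proof.
move=> r0; pose c : space3 R := (x.1.1 - r, x.1.2 - r, x.2 - r).
have -> : 8 * r ^+ 3 = (2 * r) ^+ 3 by ring.
rewrite -(int3_cube c); last by lra.
apply: int3_le => z; first by case: ifP.
rewrite /ballp; case: ltP => // h; last by case: ifP.
have [h1 h2 h3] := enorm_coord (x - z).
have {h1} := le_lt_trans h1 h; have {h2} := le_lt_trans h2 h.
have {h3} := le_lt_trans h3 h.
rewrite !ltr_norml /= => /andP[? ?] /andP[? ?] /andP[? ?].
rewrite ifT// /cubep/=; apply/andP; split; [lra|apply/and5P; split; lra].
Qed.

Lemma int3_ball_ge x r : 0 <= r ->
  ((r ^+ 3 / 8)%:E <= int3 (fun z => (if ballp x r z then 1 else 0)%R))%E.
Proof.
move=> r0.
have -> : r ^+ 3 / 8 = (r / 2) ^+ 3 by field.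
rewrite -(int3_cube x); last by lra.
apply: int3_le => z; first by case: ifP.
case: ifP => // h; last by case: ifP.
move: h => /andP[h1 /and5P[h2 h3 h4 h5 h6]].
have r1 : 0 < r by lra.
rewrite ifT// /ballp; apply: enorm_lt => //=.
have e1 : (x.1.1 - z.1.1) ^+ 2 <= r ^+ 2 / 4 by nra.
have e2 : (x.1.2 - z.1.2) ^+ 2 <= r ^+ 2 / 4 by nra.
have e3 : (x.2 - z.2) ^+ 2 <= r ^+ 2 / 4 by nra.
nra.
Qed.

Lemma geo_sum_le (rho : R) n : 0 <= rho -> rho < 1 ->
  \sum_(0 <= k < n) rho ^+ k <= (1 - rho)^-1.
Proof.
move=> r0 r1; have h : 0 < 1 - rho by lra.
rewrite -[leRHS]div1r ler_pdivlMr// mulrC.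
have -> : (1 - rho) * (\sum_(0 <= k < n) rho ^+ k) = 1 - rho ^+ n.
  elim: n => [|n IH]; first by rewrite big_geq// mulr0 expr0 subrr.
  by rewrite big_nat_recr//= mulrDr IH exprS; ring.
by rewrite gerBl exprn_ge0.
Qed.

(** [f] is below the sum of the [c k] times the indicators of the balls of
    radius [r k], and the integrals of these terms form a geometric series. *)
Lemma int3_shells f x (c r : nat -> R) (A rho : R) :
  (forall z, 0 <= f z) -> 0 <= A -> 0 <= rho -> rho < 1 ->
  (forall k, 0 <= c k) -> (forall k, 0 <= r k) ->
  (forall k, c k * r k ^+ 3 <= A * rho ^+ k) ->
  (forall z, f z = 0 \/ exists k, enorm (x - z) < r k /\ f z <= c k) ->
  (int3 f <= (8 * A / (1 - rho))%:E)%E.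
Proof.
move=> f0 A0 r0 r1 c0 rk0 crA fc.
pose g k z : R := c k * (if ballp x (r k) z then 1 else 0).
have g0 k z : 0 <= g k z by rewrite /g mulr_ge0//; case: ifP.
have mi k : borel3 (fun z => if ballp x (r k) z then 1 else 0).
  by rewrite /ballp; bor.
have mg k : borel3 (g k) := borel3M (borel3_cst _) (mi k).
apply: (@le_trans _ _ (\int[volume3 R]_z (\sum_(0 <= k <oo) (g k z)%:E))%E).
  rewrite int3E; apply: integral_mono => z; first by rewrite lee_fin.
  have [->|[k [h1 h2]]] := fc z.
    by apply: nneseries_ge0 => k _ _; rewrite lee_fin.
  apply: le_trans (nneseries_lim_ge k.+1 _) => //; last first.
    by move=> i _; rewrite lee_fin.
  rewrite big_nat_recr//= -[leLHS]add0e; apply: leeD.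
    by apply: sume_ge0 => i _; rewrite lee_fin.
  by rewrite lee_fin /g ifT// mulr1.
have mge k : measurable_fun [set: mspace R] (fun z => (g k z)%:E).
  by apply/measurable_EFinP; exact: mg.
have ge0 k z : [set: mspace R] z -> (0 <= (g k z)%:E)%E by rewrite lee_fin.
rewrite (@integral_nneseries _ _ R (volume3 R) _ measurableT
  (fun k z => (g k z)%:E) mge ge0).
apply: lime_le.
  by apply: is_cvg_nneseries => k _ _; apply: integral_ge0 => z _; rewrite lee_fin.
apply: nearW => n.
apply: (@le_trans _ _ (\sum_(0 <= k < n) (8 * A * rho ^+ k)%:E)%E).
  apply: lee_sum => k _; rewrite -int3E (int3Z (mi k))//; last by move=> z; case: ifP.
  apply: (@le_trans _ _ ((c k)%:E * (8 * r k ^+ 3)%:E)%E).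
    by apply: lee_wpmul2l; [rewrite lee_fin|exact: int3_ball_le].
  by rewrite -EFinM lee_fin; have := crA k; nra.
rewrite sumEFin lee_fin -mulr_sumr; apply: ler_wpM2l; first by lra.
exact: geo_sum_le.
Qed.

End Balls.


(** * Integrals of powers of the distance *)

Section Powers.
Context {R : realType}.
Implicit Types (f : space3 R -> R) (x z : space3 R).

Lemma powR_lt1 (x s : R) : 0 <= x < 1 -> 0 < s -> x `^ s < 1.
Proof.
move=> /andP[x0 x1] s0; have -> : 1 = 1 `^ s :> R by rewrite powR1.
by apply: (gt0_ltr_powR s0); rewrite ?nnegrE.
Qed.

Lemma powRX (x s : R) k : 0 <= x -> (x ^+ k) `^ s = (x `^ s) ^+ k.
Proof.
move=> x0; rewrite -(powR_mulrn k x0) -(powR_mulrn k (powR_ge0 _ _)).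
exact: powRAC.
Qed.

Lemma powRNM (x s : R) : 0 < x -> x `^ (- s) * x `^ s = 1.
Proof. by move=> x0; rewrite powRN mulVf// gt_eqF// powR_gt0. Qed.

Lemma powR_cube (x s : R) : 0 < x -> x `^ (- s) * x ^+ 3 = x `^ (3 - s).
Proof.
move=> x0; rewrite -(powR_mulrn 3 (ltW x0)) -powRD.
  by rewrite addrC.
by rewrite (gt_eqF x0) implybT.
Qed.

Lemma powR_anti (s x y : R) : 0 <= s -> 0 < x -> x <= y ->
  y `^ (- s) <= x `^ (- s).
Proof.
move=> s0 x0 xy; rewrite !powRN lef_pV2 ?posrE ?powR_gt0//.
  by apply: ge0_ler_powR => //; rewrite nnegrE; lra.
exact: lt_le_trans xy.
Qed.

Lemma dyadic_up (r t : R) : 0 < r -> r <= t ->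
  exists k, r * 2 ^+ k <= t < r * 2 ^+ k.+1.
Proof.
move=> r0 rt.
have ex : exists n, t < r * 2 ^+ n.
  exists (Num.bound (t / r)); rewrite mulrC -ltr_pdivrMr//.
  exact: upper_nthrootP.
case: (ex_minnP ex) => -[|k]; first by rewrite expr0 mulr1 ltNge rt.
move=> h hmin; exists k; rewrite h andbT leNgt; apply/negP => /hmin.
by rewrite ltnn.
Qed.

Lemma dyadic_down (r t : R) : 0 < t -> t < r ->
  exists k, r / 2 ^+ k.+1 <= t < r / 2 ^+ k.
Proof.
move=> t0 tr.
have ex : exists n, r / 2 ^+ n <= t.
  exists (Num.bound (r / t)); rewrite ler_pdivrMr ?exprn_gt0//.
  by rewrite mulrC -ler_pdivrMr//; apply/ltW; exact: upper_nthrootP.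
case: (ex_minnP ex) => -[|k]; first by rewrite expr0 divr1 leNgt tr.
move=> h hmin; exists k; rewrite h/= ltNge; apply/negP => /hmin.
by rewrite ltnn.
Qed.

(** Dyadic shells of radii [r / 2 ^ k]. The value at the center belongs to no
    shell; the number [e] says from which shell on it is harmless. *)
Lemma int3_near (s : R) : 0 <= s -> s < 3 -> exists C, 0 <= C /\
  forall f x (D r e : R), 0 <= D -> 0 < e -> e < r ->
    (forall z, 0 <= f z) -> (forall z, r <= enorm (x - z) -> f z = 0) ->
    (forall z, 0 < enorm (x - z) -> f z <= D * enorm (x - z) `^ (- s)) ->
    f x <= D * e `^ (- s) ->
  (int3 f <= (C * D * r `^ (3 - s))%:E)%E.
Proof.
move=> s0 s3; pose rho : R := 2^-1 `^ (3 - s).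
have rho0 : 0 <= rho by exact: powR_ge0.
have rho1 : rho < 1 by apply: powR_lt1; lra.
have d1 : 0 < 1 - rho by lra.
exists (8 * 2 `^ s / (1 - rho)); split.
  by apply: divr_ge0; [rewrite mulr_ge0// powR_ge0|exact: ltW].
move=> f x D r e D0 e0 er f0 fr fD fe.
have r0 : 0 < r by lra.
have c0 k : 0 < r / 2 ^+ k.+1 by rewrite divr_gt0// exprn_gt0.
apply: le_trans (int3_shells (x := x)
  (c := fun k => D * (r / 2 ^+ k.+1) `^ (- s)) (r := fun k => r / 2 ^+ k)
  (A := D * 2 `^ s * r `^ (3 - s)) (rho := rho) _ _ _ _ _ _ _ _) _ => //.
- by rewrite !mulr_ge0// powR_ge0.
- by move=> k; rewrite mulr_ge0// powR_ge0.
- by move=> k; rewrite divr_ge0// ?exprn_ge0// ltW.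
- move=> k; rewrite le_eqVlt; apply/orP; left; apply/eqP.
  have t0 : 0 < r / 2 ^+ k by rewrite divr_gt0// exprn_gt0.
  have -> : r / 2 ^+ k.+1 = 2^-1 * (r / 2 ^+ k).
    by rewrite exprS invfM; ring.
  rewrite powRM ?(ltW t0)// ?invr_ge0//.
  have -> : 2^-1 `^ (- s) = 2 `^ s :> R.
    by rewrite -powR_inv1// -powRrM mulN1r opprK.
  transitivity (D * 2 `^ s * ((r / 2 ^+ k) `^ (- s) * (r / 2 ^+ k) ^+ 3)).
    by ring.
  rewrite powR_cube// powRM ?(ltW r0)// ?invr_ge0 ?exprn_ge0//.
  by rewrite -exprVn powRX ?invr_ge0// /rho; ring.
- move=> z; have [h|h] := leP r (enorm (x - z)); first by left; exact: fr.
  have [h0|h0] := ltP 0 (enorm (x - z)).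
    have [k /andP[k1 k2]] := dyadic_down h0 h.
    right; exists k; split => //; apply: le_trans (fD z h0) _.
    by apply: ler_wpM2l => //; exact: powR_anti.
  have xz : x = z.
    apply/eqP; rewrite -subr_eq0; apply/eqP/enorm_eq0/eqP.
    by rewrite eq_le h0 enorm_ge0.
  have [k /andP[k1 k2]] := dyadic_down e0 er.
  right; exists k; split; first exact: le_lt_trans h0 (lt_trans e0 k2).
  rewrite -xz; apply: le_trans fe _; apply: ler_wpM2l => //; exact: powR_anti.
- by rewrite lee_fin le_eqVlt; apply/orP; left; apply/eqP; field; lra.
Qed.

(** Dyadic shells of radii [r * 2 ^ k]. *)
Lemma int3_far (s : R) : 3 < s -> exists C, 0 <= C /\
  forall f x (D r : R), 0 <= D -> 0 < r ->
    (forall z, 0 <= f z) -> (forall z, enorm (x - z) < r -> f z = 0) ->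
    (forall z, r <= enorm (x - z) -> f z <= D * enorm (x - z) `^ (- s)) ->
  (int3 f <= (C * D * r `^ (3 - s))%:E)%E.
Proof.
move=> s3; pose rho : R := 2^-1 `^ (s - 3).
have rho0 : 0 <= rho by exact: powR_ge0.
have rho1 : rho < 1 by apply: powR_lt1; lra.
have d1 : 0 < 1 - rho by lra.
exists (64 / (1 - rho)); split; first by apply: divr_ge0 => //; exact: ltW.
move=> f x D r D0 r0 f0 fr fD.
have t0 k : 0 < r * 2 ^+ k by rewrite mulr_gt0// exprn_gt0.
apply: le_trans (int3_shells (x := x)
  (c := fun k => D * (r * 2 ^+ k) `^ (- s)) (r := fun k => r * 2 ^+ k.+1)
  (A := 8 * D * r `^ (3 - s)) (rho := rho) _ _ _ _ _ _ _ _) _ => //.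
- by rewrite !mulr_ge0// powR_ge0.
- by move=> k; rewrite mulr_ge0// powR_ge0.
- by move=> k; rewrite mulr_ge0// ?exprn_ge0// ltW.
- move=> k; rewrite le_eqVlt; apply/orP; left; apply/eqP.
  transitivity (8 * D * ((r * 2 ^+ k) `^ (- s) * (r * 2 ^+ k) ^+ 3)).
    by rewrite (_ : r * 2 ^+ k.+1 = 2 * (r * 2 ^+ k)) ?(exprS 2 k); ring.
  rewrite powR_cube// powRM ?(ltW r0)// ?exprn_ge0// powRX//.
  have -> : 2 `^ (3 - s) = rho.
    have -> : 3 - s = -1 * (s - 3) by ring.
    by rewrite powRrM powR_inv1.
  by ring.
- move=> z; have [h|h] := ltP (enorm (x - z)) r; first by left; exact: fr.
  have [k /andP[k1 k2]] := dyadic_up r0 h.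
  right; exists k; split => //; apply: le_trans (fD z h) _.
  by apply: ler_wpM2l => //; apply: powR_anti => //; lra.
- by rewrite lee_fin le_eqVlt; apply/orP; left; apply/eqP; field; lra.
Qed.

End Powers.


(** * The kernel *)

Section Kernel.
Context {R : realType}.

(** The kernel as a function of the distance, with its limit [a^-1] at [0];
    extending it by a constant to negative numbers makes it nonincreasing on
    the whole line, hence Borel. *)
Definition kern (a t : R) : R :=
  if t <= 0 then a^-1 else (1 - expR (- (t / a))) / t.

Implicit Types a s t : R.

Lemma expRN_lt (s : R) : 0 < s -> expR (- s) * (1 + s) < 1.
Proof.
move=> s0; rewrite expRN mulrC ltr_pdivrMr ?expR_gt0// mul1r.
by apply: expR_gt1Dx; rewrite gt_eqF.
Qed.

Lemma kern_le0 a t : t <= 0 -> kern a t = a^-1.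
Proof. by rewrite /kern => ->. Qed.

Lemma kern_gt0E a t : 0 < t -> kern a t = (1 - expR (- (t / a))) / t.
Proof. by rewrite /kern leNgt => ->. Qed.

Lemma kern_gt0 a t : 0 < a -> 0 < kern a t.
Proof.
move=> a0; rewrite /kern; case: (leP t 0) => t0; first by rewrite invr_gt0.
rewrite divr_gt0// subr_gt0 -expR0 ltr_expR oppr_lt0.
exact: divr_gt0.
Qed.

Lemma kern_le_inv a t : 0 < t -> kern a t <= t^-1.
Proof.
move=> t0; rewrite kern_gt0E// -[leRHS]mul1r.
by rewrite ler_wpM2r ?invr_ge0 ?(ltW t0)// gerBl expR_ge0.
Qed.

Lemma kern_le_max a t : 0 < a -> kern a t <= a^-1.
Proof.
move=> a0; rewrite /kern; case: (leP t 0) => // t0.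
rewrite ler_pdivrMr// lerBlDr -lerBlDl.
by have := expR_ge1Dx (- (t / a)); rewrite [t / a]mulrC.
Qed.

Lemma kern_ge a t : 0 < a -> 0 <= t -> (a + t)^-1 <= kern a t.
Proof.
move=> a0; rewrite le_eqVlt => /predU1P[<-|t0]; first by rewrite kern_le0// addr0.
rewrite kern_gt0E// ler_pdivlMr// mulrC ler_pdivrMr ?addr_gt0//.
have := expRN_lt (divr_gt0 t0 a0); set e := expR _.
have -> : 1 + t / a = (a + t) / a by field; rewrite gt_eqF.
rewrite mulrA ltr_pdivrMr// => h; nra.
Qed.

Lemma kern_le2 a t : 0 < a -> 0 <= t -> kern a t <= 2 / (a + t).
Proof.
move=> a0 t0; have at0 : 0 < a + t by lra.
have [ta|ta] := leP t a.
  apply: le_trans (kern_le_max t a0) _.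
  by rewrite ler_pdivlMr// mulrC ler_pdivrMr//; lra.
have t1 : 0 < t by lra.
apply: le_trans (kern_le_inv a t1) _.
by rewrite ler_pdivlMr// mulrC ler_pdivrMr//; lra.
Qed.

(** Both values are comparable with [1 / (a + t)]. *)
Lemma kern_double a s t : 0 < a -> 0 <= s -> s <= 2 * t ->
  kern a t <= 4 * kern a s.
Proof.
move=> a0 s0 st; have t0 : 0 <= t by lra.
have h1 := kern_le2 a0 t0; have h2 := kern_ge a0 s0.
apply: le_trans h1 _; apply: le_trans (ler_wpM2l _ h2); last by [].
have p1 : 0 < a + t by lra.
have p2 : 0 < a + s by lra.
by rewrite ler_pdivrMr// mulrAC ler_pdivlMr//; lra.
Qed.

(** The derivative has the sign of [e^-x (1 + x) - 1]; the proof is the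
    finite-increment form of this computation. *)
Lemma kern_decr a s t : 0 < a -> 0 <= s -> s < t -> kern a t < kern a s.
Proof.
move=> a0; rewrite le_eqVlt => /predU1P[<- t0|s0 st].
  rewrite (kern_le0 a (lexx 0)) kern_gt0E// ltr_pdivrMr//.
  have : - (t / a) != 0 by rewrite oppr_eq0 gt_eqF// divr_gt0.
  by move=> /expR_gt1Dx; lra.
have t0 : 0 < t by lra.
rewrite !kern_gt0E//.
set x := s / a; set d := (t - s) / a; set e := expR (- x).
have d0 : 0 < d by rewrite divr_gt0// subr_gt0.
have x0 : 0 < x by rewrite divr_gt0.
have sx : s = a * x by rewrite /x; field; rewrite gt_eqF.
have td : t = a * (x + d) by rewrite /x /d; field; rewrite gt_eqF.
have -> : expR (- (t / a)) = e * expR (- d).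
  by rewrite -expRD; congr expR; rewrite td; field; rewrite gt_eqF.
have h1 : 1 - d < expR (- d) by apply: expR_gt1Dx; rewrite oppr_eq0 gt_eqF.
have e0 : 0 < e by exact: expR_gt0.
have h2 : e * (1 + x) < 1 by exact: expRN_lt.
rewrite ltr_pdivrMr// mulrAC ltr_pdivlMr// td sx.
have h1' : 0 < expR (- d) - (1 - d) by lra.
have h2' : 0 < 1 - e * (1 + x) by lra.
have h5 : 0 < a * x * (e * (expR (- d) - (1 - d))).
  apply: mulr_gt0; first exact: mulr_gt0.
  exact: mulr_gt0.
have h6 : 0 < a * (d * (1 - e * (1 + x))) by do 2?apply: mulr_gt0.
nra.
Qed.

Lemma kern_noninc a : 0 < a -> {homo kern a : s t /~ t <= s}.
Proof.
move=> a0 s t; have [s0 _|s0] := leP s 0.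
  by rewrite [leRHS]kern_le0//; exact: kern_le_max.
rewrite le_eqVlt => /predU1P[->//|st]; apply/ltW/kern_decr => //.
exact: ltW.
Qed.

(** [kern a t] is [a^-1] times the mean of [expR (- k * t / a)] over [k] in
    [[0, 1]], and each of these exponentials loses at most [expR (- d / a)]
    when [t] increases by [d]. The proof reduces this to [1 + x <= expR x]. *)
Lemma kern_harnack a t d : 0 < a -> 0 <= t -> 0 <= d ->
  kern a t <= expR (d / a) * kern a (t + d).
Proof.
move=> a0 t0; rewrite le_eqVlt => /predU1P[<-|d0].
  by rewrite mul0r expR0 mul1r addr0.
have td0 : 0 < t + d by lra.
set x := t / a; set y := d / a.
have x0 : 0 <= x by rewrite divr_ge0// ltW.
have y0 : 0 < y by rewrite divr_gt0.
have ty : t = a * x by rewrite /x; field; rewrite ?gt_eqF.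
have dy : d = a * y by rewrite /y; field; rewrite ?gt_eqF.
have E : expR y * kern a (t + d) = (expR y - expR (- x)) / (t + d).
  rewrite kern_gt0E// mulrA; congr (_ / _).
  rewrite mulrBr mulr1 -expRD; congr (_ - expR _).
  by rewrite ty dy; field; rewrite ?gt_eqF.
rewrite E; have hy := expR_ge1Dx y.
have hx := expR_ge1Dx (- x).
move: t0; rewrite le_eqVlt => /predU1P[t0|t0].
  rewrite kern_le0 ?t0// ler_pdivlMr// /x -t0 mul0r oppr0 expR0 add0r.
  by rewrite mulrC -/y; lra.
rewrite kern_gt0E// -/x ler_pdivlMr// mulrAC ler_pdivrMr//.
have ex0 := expR_ge0 (- x).
have h1 : 0 <= expR y - 1 - y by lra.
have h2 : 0 <= expR (- x) - 1 + x by lra.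
have := mulr_ge0 (ltW a0) (mulr_ge0 x0 h1).
have := mulr_ge0 (ltW a0) (mulr_ge0 (ltW y0) h2).
rewrite ty dy; nra.
Qed.

Lemma bp_kernelE a (x : space3 R) : x != 0 -> bp_kernel a x = kern a (enorm x).
Proof. by move=> /enorm_gt0 x0; rewrite kern_gt0E. Qed.

Lemma borel3_kern a f : 0 < a -> borel3 f -> borel3 (fun x => kern a (f x)).
Proof. by move=> a0; apply: borel3_noninc; exact: kern_noninc. Qed.

Lemma borel3_kerns a (x : space3 R) : 0 < a ->
  borel3 (fun y => kern a (enorm (x - y))).
Proof. by move=> a0; apply: borel3_kern => //; bor. Qed.

End Kernel.


(** * Borel regularity of solutions *)

Section NullSets.
Import HBNNSimple.
Context {R : realType}.
Implicit Types (f g : space3 R -> R) (N : set (mspace R)).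

(** Removing [N] does not change the integral of the simple functions below
    [f], so [f] itself may be arbitrary. *)
Lemma integral_null_le N (f : space3 R -> \bar R) : measurable N ->
  volume3 R N = 0%E -> (forall x, 0 <= f x)%E ->
  (\int[volume3 R]_x f x <= \int[volume3 R]_x (f \_ (~` N)) x)%E.
Proof.
move=> mN N0 f0; have fN0 x : (0 <= (f \_ (~` N)) x)%E.
  by rewrite patchE; case: ifP.
rewrite [leLHS]ge0_integralTE//; apply: ge_ereal_sup => _ [h /= hf <-].
have mh : measurable_fun [set: mspace R] (fun x => (h x)%:E) by exact/measurable_EFinP.
have -> : sintegral (volume3 R) h = (\int[volume3 R]_x (h x)%:E)%E.
  by rewrite integral_nnsfun// patch_setT.
have h0 x : [set: mspace R] x -> (0 <= (h x)%:E)%E by rewrite lee_fin.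
rewrite (ge0_negligible_integral mN measurableT mh h0 N0).
rewrite setTD integral_mkcond; apply: integral_mono => x.
  by rewrite patchE; case: ifP => // _; rewrite lee_fin.
by rewrite !patchE; case: ifP.
Qed.

Lemma int3_null N f g : measurable N -> volume3 R N = 0%E ->
  (forall x, 0 <= f x) -> (forall x, 0 <= g x) ->
  (forall x, ~ N x -> f x = g x) -> int3 f = int3 g.
Proof.
move=> mN N0.
suff H f' g' : (forall x, 0 <= f' x) -> (forall x, 0 <= g' x) ->
    (forall x, ~ N x -> f' x = g' x) -> (int3 f' <= int3 g')%E.
  move=> f0 g0 fg; apply/eqP; rewrite eq_le !H// => x Nx.
  by rewrite fg.
move=> f0 g0 fg; rewrite !int3E.
apply: le_trans (integral_null_le mN N0 _) _.
  by move=> x; rewrite lee_fin.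
apply: integral_mono => x; rewrite patchE; case: ifPn => //.
- by rewrite lee_fin.
- by rewrite inE => /fg ->.
- by rewrite lee_fin.
Qed.

Lemma volume3_point (x : space3 R) :
  measurable ([set x] : set (mspace R)) /\ volume3 R [set x] = 0%E.
Proof.
have E : [set x] = [set x.1.1] `*` [set x.1.2] `*` [set x.2].
  apply/seteqP; split => [z -> //|[[z1 z2] z3] /= [[-> ->] ->]].
  by case: x => [[]].
have m1 (t : R) : measurable ([set t] : set (measurableTypeR R)).
  exact: measurable_set1.
rewrite E; split; first by do 2?apply: measurableX.
transitivity (area ([set x.1.1] `*` [set x.1.2])
    * lebesgue_measure ([set x.2] : set R))%E.
  by apply: (product_measure1E area) => //; exact: measurableX.
by rewrite lebesgue_measure_set1 mule0.
Qed.

(** The rays with rational endpoints generate the Borel sets, and each of their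
    preimages is Borel up to a null set; the union of these countably many null
    sets can be removed. *)
Lemma lebesgue_measurable3_borel (u : space3 R -> R) :
  lebesgue_measurable3 u -> exists N : set (mspace R),
    [/\ measurable N, volume3 R N = 0%E
      & borel3 (fun x => if x \in N then 0 else u x)].
Proof.
move=> mu.
have /choice[F FP] : forall c : rat, exists AM : set (mspace R) * set (mspace R),
    [/\ measurable AM.1, measurable AM.2, volume3 R AM.2 = 0%E,
      AM.1 `<=` u @^-1` `]ratr c, +oo[%classic
    & u @^-1` `]ratr c, +oo[%classic `<=` AM.1 `|` AM.2].
  move=> c; have [|A mA [N [M [mM M0 NM]] E]] := mu `]ratr c, +oo[%classic.
    exact: measurable_itv.
  exists (A, M); rewrite /= -E; split => //.
  exact: setUS.
pose N := \bigcup_n (F (odflt 0 (unpickle n))).2.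
have mN : measurable N by apply: bigcupT_measurable => n; case: (FP (odflt 0 (unpickle n))).
have N0 : volume3 R N = 0%E.
  apply: measure_negligible => //; apply: negligible_bigcup => n.
  have [_ m2 z2 _ _] := FP (odflt 0 (unpickle n)).
  by apply/negligibleP.
have FN c : (F c).2 `<=` N.
  by move=> x Fx; exists (pickle c) => //; rewrite pickleK.
exists N; split => //.
have -> : (fun x => if x \in N then 0 else u x) = (u : mspace R -> R) \_ (~` N).
  apply/funext => x; rewrite patchE in_setC; by case: (x \in N).
have mCN : measurable (~` N) by exact: measurableC.
apply/(measurable_restrictT _ mCN).
apply: (measurability _ (RGenOInfty.measurableE R)) => //= _ [_ [r ->]] <-.
rewrite (_ : _ `&` _ = \bigcup_(c in [set c : rat | r < ratr c])
    ((F c).1 `\` N)); last first.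
  apply/seteqP; split => x /=.
    rewrite in_itv/= andbT => -[Nx rx].
    have /rat_in_itvoo[c] := rx; rewrite in_itv/= => /andP[rc cx].
    have [_ _ _ _ sub] := FP c.
    exists c => //; split => //.
    have [] // := sub x; first by rewrite /= in_itv/= cx.
    by move/FN.
  move=> [c /= rc [Fx Nx]]; split => //; rewrite in_itv/= andbT.
  have [_ _ _ sub _] := FP c.
  by have := sub x Fx; rewrite /= in_itv/= andbT; exact: lt_trans.
rewrite bigcup_mkcond; apply: bigcupT_measurable_rat => c.
case: ifP => _; last exact: measurable0.
by apply: measurableD => //; case: (FP c).
Qed.

End NullSets.

Section Potential.
Context {R : realType}.

(** A named copy of [volume3], carrying its sigma-finiteness. *)
Definition volume : set (mspace R) -> \bar R := (area \x @lebesgue_measure R)%E.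
HB.instance Definition _ := Measure.on volume.

Lemma volume_sigma_finite : sigma_finite setT volume.
Proof.
have /sigma_finiteP[F [TF ndF Foo]] := sigma_finiteT (@area R).
have /sigma_finiteP[G [TG ndG Goo]] := sigma_finiteT (@lebesgue_measure R).
exists (fun n => F n `*` G n).
 rewrite -setXTT TF TG predeqE => -[x y]; split.
    move=> [/= [n _ Fnx] [k _ Gky]]; exists (maxn n k) => //; split.
    - by move: x Fnx; exact/subsetPset/ndF/leq_maxl.
    - by move: y Gky; exact/subsetPset/ndG/leq_maxr.
  by move=> [n _ []/= ? ?]; split; exists n.
move=> k; have [? ?] := Foo k; have [? ?] := Goo k.
split; first exact: measurableX.
by rewrite /volume/= product_measure1E// lte_mul_pinfty// ge0_fin_numE.
Qed.

HB.instance Definition _ :=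
  Measure_isSigmaFinite.Build _ _ _ volume volume_sigma_finite.

(** Tonelli's theorem: a partial integral of a Borel function is Borel. *)
Lemma borel3_potential (k f u : space3 R -> R) : borel3 k -> borel3 f ->
  (forall x, 0 <= k x) -> (forall x, 0 <= f x) ->
  (forall x, (u x)%:E = int3 (fun y => k (x - y) * f y)) -> borel3 u.
Proof.
move=> mk mf k0 f0 uE; apply/measurable_EFinP.
pose h (z : (mspace R * mspace R)%type) : \bar R :=
  (k ((z.1 : space3 R) - z.2) * f z.2)%:E.
have -> : (EFin \o u) = (fun x => \int[volume]_y h (x, y))%E.
  by apply/funext => x /=; rewrite uE int3E.
apply: (@measurable_fun_fubini_tonelli_F _ _ _ _ _ volume h).
  apply/measurable_EFinP; apply: measurable_funM.
    apply: (measurableT_comp mk).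
    have m1 (pr : mspace R -> measurableTypeR R) : measurable_fun setT pr ->
        measurable_fun [set: (mspace R * mspace R)%type]
          (fun z => ((pr z.1 : R) - pr z.2) : R).
      move=> mp; apply: measurable_funB.
        exact: (measurableT_comp mp measurable_fst).
      exact: (measurableT_comp mp measurable_snd).
    apply: measurable_fun_pair; last exact: (m1 _ borel3_x3).
    by apply: measurable_fun_pair;
      [exact: (m1 _ borel3_x1)|exact: (m1 _ borel3_x2)].
  exact: (measurableT_comp mf measurable_snd).
by move=> z; rewrite lee_fin mulr_ge0.
Qed.

End Potential.

Section Solutions.
Context {R : realType}.

(** The integral equation for a Borel function, with the kernel in the form
    [kern], which differs from [bp_kernel] only at the origin. *)
Definition solves (a q : R) (u : space3 R -> R) :=
  [/\ borel3 u, forall x, 0 < u x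
    & forall x, (u x)%:E = int3 (fun y => kern a (enorm (x - y)) * u y `^ q)].

(** The integral does not see the null set where [u] differs from a Borel
    function; hence [u], being given everywhere by the integral, is the
    potential of a Borel function. *)
Lemma positive_solution_solves (a q : R) u : 0 < a -> 0 < q ->
  lebesgue_measurable3 u -> is_positive_solution a q u -> solves a q u.
Proof.
move=> a0 q0 mu [u0 uE].
have [N [mN N0 mv]] := lebesgue_measurable3_borel mu.
pose v x := if x \in N then 0 else u x.
have v0 x : 0 <= v x by rewrite /v; case: ifP => // _; exact: ltW.
have bk0 z : 0 <= bp_kernel a z.
  have [->|z0] := eqVneq z 0; first by rewrite /bp_kernel enorm0 invr0 mulr0.
  by rewrite bp_kernelE//; apply/ltW/kern_gt0.
have uE1 x : (u x)%:E = int3 (fun y => kern a (enorm (x - y)) * u y `^ q).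
  have [mx x0] := volume3_point x.
  rewrite uE -int3E; apply: (int3_null mx x0) => y.
  - by rewrite mulr_ge0// powR_ge0.
  - by rewrite mulr_ge0// ?powR_ge0//; apply/ltW/kern_gt0.
  - move=> xy; rewrite bp_kernelE// subr_eq0; apply/eqP => xy'.
    exact: xy.
split => //.
apply: (@borel3_potential _ (fun z => kern a (enorm z)) (fun y => v y `^ q)).
- by apply: borel3_kern => //; bor.
- by apply: borel3_powR.
- by move=> z; apply/ltW/kern_gt0.
- by move=> z; exact: powR_ge0.
move=> x; rewrite uE1; apply: (int3_null mN N0) => y.
- by rewrite mulr_ge0// ?powR_ge0//; apply/ltW/kern_gt0.
- by rewrite mulr_ge0// ?powR_ge0//; apply/ltW/kern_gt0.
- by move=> Ny; rewrite /v memNset.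
Qed.

End Solutions.


(** * Harnack inequality and first consequences *)

Section Dominated.
Context {R : realType}.
Implicit Types (f g : space3 R -> R).

(** Dominated convergence for sequences that are eventually zero at almost
    every point. *)
Lemma int3_vanishing (f : nat -> space3 R -> R) g N :
  measurable (N : set (mspace R)) -> volume3 R N = 0%E ->
  (forall n, borel3 (f n)) -> borel3 g ->
  (forall n x, 0 <= f n x <= g x) -> (int3 g < +oo)%E ->
  (forall x, ~ N x -> exists n0, forall n, (n0 <= n)%N -> f n x = 0) ->
  forall e, 0 < e -> exists n, (int3 (f n) <= e%:E)%E.
Proof.
move=> mN N0 mf mg fg gfin fz e e0.
have mfe n : measurable_fun [set: mspace R] (fun x => (f n x)%:E).
  by apply/measurable_EFinP; exact: mf.
have mge : measurable_fun [set: mspace R] (fun x => (g x)%:E).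
  by apply/measurable_EFinP.
have g0 x : 0 <= g x by have /andP[h1 h2] := fg 0%N x; exact: le_trans h2.
have ig : (volume3 R).-integrable setT (fun x => (g x)%:E).
  apply/integrableP; split => //.
  rewrite (_ : (fun x => `|(g x)%:E|)%E = fun x => (g x)%:E).
    by rewrite -int3E.
  by apply/funext => x; rewrite gee0_abs// lee_fin.
have ae1 : {ae volume3 R, forall x, setT x ->
    (f n x)%:E @[n --> \oo] --> (cst 0%E : mspace R -> \bar R) x}.
  exists N; split => // x /= nx; apply/not_notP => Nx; apply: nx => _.
  have [n0 h] := fz x Nx.
  rewrite /=; apply: cvg_near_cst.
  by exists n0 => // n /= nn; rewrite h.
have ae2 : {ae volume3 R, forall x, forall n, setT x ->
    (`|(f n x)%:E| <= (g x)%:E)%E}.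
  by apply: aeW => x n _; have /andP[h1 h2] := fg n x; rewrite gee0_abs lee_fin.
have [_ _] := dominated_convergence measurableT mfe (measurable_cst _) ae1 ig ae2.
rewrite integral_cst// mul0e => /fine_cvgP[h1 /cvgrPdist_le h2].
have [n1 _ h1'] := h1; have [n2 _ h2'] := h2 e e0.
exists (maxn n1 n2).
have := h2' (maxn n1 n2) (leq_maxr _ _).
have := h1' (maxn n1 n2) (leq_maxl _ _).
rewrite /= sub0r normrN int3E => fin h.
rewrite -(fineK fin) lee_fin; exact: le_trans (ler_norm _) h.
Qed.

Lemma int3_tail f : borel3 f -> (forall x, 0 <= f x) -> (int3 f < +oo)%E ->
  forall e, 0 < e -> exists rho, 0 < rho /\
    (int3 (fun x => if rho <= enorm x then f x else 0)%R <= e%:E)%E.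
Proof.
move=> mf f0 ffin e e0.
pose g n x := if n.+1%:R <= enorm x then f x else 0.
have [n h] : exists n, (int3 (g n) <= e%:E)%E.
  apply: (@int3_vanishing g f set0) => //.
  - by rewrite /g => n; bor.
  - by move=> n x; rewrite /g; case: ifP => _; rewrite ?lexx ?f0.
  - move=> x _; exists (Num.bound (enorm x)) => n nn; rewrite /g ifF//.
    apply/negbTE; rewrite -ltNge.
    apply: lt_le_trans (archi_boundP (enorm_ge0 x)) _.
    by rewrite ler_nat; exact: leqW.
by exists n.+1%:R.
Qed.

End Dominated.

Section Harnack.
Context {R : realType}.
Implicit Types (a q : R) (u : space3 R -> R) (x y : space3 R).

Lemma solves_integrand_ge0 a q u : 0 < a ->
  forall x y, 0 <= kern a (enorm (x - y)) * u y `^ q.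
Proof. by move=> a0 x y; rewrite mulr_ge0 ?powR_ge0//; exact/ltW/kern_gt0. Qed.

Lemma solves_borel_integrand a q u x : 0 < a -> borel3 u ->
  borel3 (fun y => kern a (enorm (x - y)) * u y `^ q).
Proof.
by move=> a0 mu; apply: borel3M; [exact: borel3_kerns|exact: borel3_powR].
Qed.

(** [kern_harnack] under the integral sign. *)
Lemma solution_harnack a q u : 0 < a -> solves a q u ->
  forall x x', u x <= expR (enorm (x - x') / a) * u x'.
Proof.
move=> a0 [mu u0 uE] x x'; set d := enorm _.
have d0 : 0 <= d := enorm_ge0 _.
rewrite -lee_fin EFinM !uE.
rewrite -int3Z ?expR_ge0//; last 2 first.
- exact: solves_borel_integrand.
- exact: solves_integrand_ge0.
apply: int3_le => y; first exact: solves_integrand_ge0.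
rewrite mulrA; apply: ler_wpM2r; first exact: powR_ge0.
apply: le_trans (kern_harnack a0 (enorm_ge0 _) d0) _.
apply: ler_wpM2l; first exact: expR_ge0.
apply: kern_noninc => //; rewrite [leRHS]addrC.
apply: le_trans (enorm_triangle x' x y) _.
by rewrite enormC.
Qed.

(** By [solution_harnack], [u] is comparable to [u x] on the unit ball. *)
Lemma solution_pointwise a q u p : 0 < a -> 0 <= p -> solves a q u -> forall x,
  ((u x `^ p / (8 * expR (p / a)))%:E <=
    int3 (fun y => (if ballp x 1 y then u y `^ p else 0)%R))%E.
Proof.
move=> a0 p0 su x; have [mu u0 uE] := su.
have e0 : 0 < expR (p / a) by exact: expR_gt0.
pose c := u x `^ p / expR (p / a).
have c0 : 0 <= c by rewrite divr_ge0 ?powR_ge0// ltW.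
have := int3_ball_ge x (@ler01 R).
rewrite expr1n => /(lee_wpmul2l (x := c%:E)) h.
apply: (@le_trans _ _ (c%:E * (1 / 8)%:E)%E).
  by rewrite -EFinM lee_fin /c invfM; lra.
apply: le_trans (h _) _; first by rewrite lee_fin.
rewrite -int3Z//; last 2 first.
- by apply: borel3_if; [exact: borelp_ball|bor|bor].
- by move=> z; case: ifP.
apply: int3_le => y.
  by rewrite mulr_ge0//; case: ifP.
case: ifP => xy; last by rewrite mulr0.
rewrite mulr1 /c ler_pdivrMr// mulrC.
have -> : expR (p / a) = expR (a^-1) `^ p.
  by rewrite -expRM mulrC.
rewrite -powRM ?expR_ge0 ?(ltW (u0 _))//.
apply: (ge0_ler_powR p0); rewrite ?nnegrE ?mulr_ge0 ?expR_ge0 ?(ltW (u0 _))//.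
apply: le_trans (solution_harnack a0 su x y) _.
apply: ler_wpM2r; first exact: ltW.
rewrite ler_expR ler_pdivrMr// mulVf ?gt_eqF//; exact: ltW.
Qed.

End Harnack.


Section FirstBounds.
Context {R : realType}.
Implicit Types (a q : R) (u : space3 R -> R) (x y : space3 R).

Lemma int3_fin (f : space3 R -> R) : (forall x, 0 <= f x) ->
  (int3 f < +oo)%E -> exists J, 0 <= J /\ int3 f = J%:E.
Proof.
move=> f0 fi; have i0 := int3_ge0 f0; exists (fine (int3 f)).
by split; [exact: fine_ge0|rewrite fineK// ge0_fin_numE].
Qed.

(** If [q <= 1] then [p = 3 * (q - 1) / 2 <= 0] and [1 <= u ^ q + u ^ p], so
    that [kern <= kern * u ^ q + a^-1 * u ^ p] would be integrable; but it is
    at least [1 / (a + |y|)], whose integral over the ball of radius [r] grows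
    like [r ^ 2]. *)
Lemma solution_exponent_gt1 a q u : 0 < a -> 0 < q -> solves a q u ->
  (int3 (fun x => (u x `^ (3 * (q - 1) / 2))%R) < +oo)%E -> 1 < q.
Proof.
move=> a0 q0 su; have [mu u0 uE] := su => fin.
rewrite ltNge; apply/negP => q1.
have [J [J0 JE]] := int3_fin (fun x => powR_ge0 _ _) fin.
set p := 3 * (q - 1) / 2 in JE.
have p0 : p <= 0 by rewrite /p; lra.
pose B := u 0 + a^-1 * J.
have ia0 : 0 <= a^-1 by rewrite invr_ge0 ltW.
have B0 : 0 <= B by rewrite addr_ge0 ?mulr_ge0// ltW.
have BE : B%:E = int3 (fun y =>
    kern a (enorm (0 - y)) * u y `^ q + a^-1 * u y `^ p).
  rewrite int3D.
  - rewrite int3Z//; [|by bor|by move=> x; exact: powR_ge0].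
    by rewrite -uE JE.
  - exact: solves_borel_integrand.
  - by bor.
  - exact: solves_integrand_ge0.
  - by move=> x; rewrite mulr_ge0 ?powR_ge0.
have H r : 0 < r -> r ^+ 3 / 8 / (a + r) <= B.
  move=> r0; have ar0 : 0 < a + r by lra.
  have iar0 : 0 <= (a + r)^-1 by rewrite invr_ge0 ltW.
  rewrite -lee_fin BE.
  apply: (@le_trans _ _ (((a + r)^-1)%:E * (r ^+ 3 / 8)%:E)%E).
    by rewrite -EFinM lee_fin mulrC.
  apply: le_trans (lee_wpmul2l _ (int3_ball_ge 0 (ltW r0))) _.
    by rewrite lee_fin.
  rewrite -int3Z//; last 2 first.
  - by apply: borel3_if; [exact: borelp_ball|bor|bor].
  - by move=> z; case: ifP.
  apply: int3_le => y; first by rewrite mulr_ge0//; case: ifP.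
  have k0 := kern_gt0 (enorm (0 - y)) a0.
  have uq := powR_ge0 (u y) q; have up := powR_ge0 (u y) p.
  have h1 : 0 <= kern a (enorm (0 - y)) * u y `^ q by rewrite mulr_ge0// ltW.
  have h2 : 0 <= a^-1 * u y `^ p by rewrite mulr_ge0.
  case: ifP => yr; last by rewrite mulr0 addr_ge0.
  rewrite mulr1; apply: (@le_trans _ _ (kern a (enorm (0 - y)))).
    apply: le_trans (kern_ge a0 (enorm_ge0 _)).
    rewrite lef_pV2 ?posrE// ?lerD2l; last by rewrite ltr_wpDr// enorm_ge0.
    exact: ltW.
  have [u1|u1] := leP 1 (u y).
    have : 1 <= u y `^ q.
      have := ge0_ler_powR (ltW q0) _ _ u1; rewrite powR1; apply;
        by rewrite nnegrE// ltW.
    by move=> h; nra.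
  have : 1 <= u y `^ p.
    have := ler_powR; rewrite -(powRr0 (u y)) => _.
    by apply: ger_powR => //; rewrite u0 ltW.
  have := kern_le_max (enorm (0 - y)) a0.
  by move=> h3 h4; nra.
pose r := a + 1 + 16 * (B + 1).
have r0 : 0 < r by rewrite /r; lra.
have := H r r0; rewrite ler_pdivrMr; last by lra.
have h1 : r * r <= r ^+ 3 by rewrite exprS expr2 ler_pM2l//; rewrite /r; nra.
have h2 : a + r <= 2 * r by rewrite /r; lra.
have h3 : B * (a + r) <= B * (2 * r) by apply: ler_wpM2l.
have h4 : 16 * (B + 1) * r <= r * r by apply: ler_wpM2r; [lra|rewrite /r; lra].
lra.
Qed.

Lemma powR_le_inv (x y p : R) : 0 < p -> 0 <= x -> 0 <= y ->
  x `^ p <= y -> x <= y `^ p^-1.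
Proof.
move=> p0 x0 y0 xy.
rewrite -[x]powRr1// -(mulfV (lt0r_neq0 p0)) powRrM.
apply: ge0_ler_powR; rewrite ?nnegrE ?invr_ge0 ?powR_ge0//; exact: ltW.
Qed.

Lemma solution_bounded a q u p : 0 < a -> 0 < p -> solves a q u ->
  (int3 (fun x => (u x `^ p)%R) < +oo)%E -> exists M, 0 < M /\
    forall x, u x <= M.
Proof.
move=> a0 p0 su fin; have [mu u0 uE] := su.
have [J [J0 JE]] := int3_fin (fun x => powR_ge0 _ _) fin.
pose D := 8 * expR (p / a).
have D0 : 0 < D by rewrite mulr_gt0// expR_gt0.
exists ((J * D) `^ p^-1 + 1); split.
  by rewrite ltr_wpDl ?powR_ge0.
move=> x; apply: (@le_trans _ _ ((J * D) `^ p^-1)); last by rewrite lerDl.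
apply: powR_le_inv => //; [exact: ltW|by rewrite mulr_ge0// ltW|].
rewrite -ler_pdivrMr// -lee_fin -JE.
apply: le_trans (solution_pointwise a0 (ltW p0) su x) _.
by apply: int3_le => y; case: ifP => _; rewrite ?powR_ge0.
Qed.

Lemma solution_vanishes a q u p : 0 < a -> 0 < p -> solves a q u ->
  (int3 (fun x => (u x `^ p)%R) < +oo)%E ->
  forall e, 0 < e -> exists rho, 0 < rho /\
    forall x, rho <= enorm x -> u x <= e.
Proof.
move=> a0 p0 su fin e e0; have [mu u0 uE] := su.
pose D := 8 * expR (p / a).
have D0 : 0 < D by rewrite mulr_gt0// expR_gt0.
have eD : 0 < e `^ p / D by rewrite divr_gt0// powR_gt0.
have [|rho [rho0 H]] := int3_tail _ (fun x => powR_ge0 (u x) p) fin eD.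
  by bor.
exists (rho + 1); split; first by lra.
move=> x xr; rewrite -(powRr1 (ltW e0)) -(mulfV (lt0r_neq0 p0)) powRrM.
apply: powR_le_inv => //; [exact: ltW|exact: powR_ge0|].
rewrite -(ler_pM2r (x := D^-1)) ?invr_gt0// -lee_fin.
apply: le_trans (solution_pointwise a0 (ltW p0) su x) _.
apply: le_trans H; apply: int3_le => y.
  by case: ifP => _; rewrite ?powR_ge0.
case: ifP => xy; last by case: ifP => _; rewrite ?powR_ge0.
rewrite ifT//; move: xy; rewrite /ballp.
have := enormD (x - y) y; rewrite subrK; lra.
Qed.

(** The mass of [u ^ q] near the origin already contributes this much. *)
Lemma solution_lower a q u : 0 < a -> 0 < q -> solves a q u ->
  exists c, 0 < c /\ forall x, c / (a + enorm x) <= u x.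
Proof.
move=> a0 q0 su; have [mu u0 uE] := su.
pose m := (u 0 / expR a^-1) `^ q.
have m0 : 0 < m by rewrite powR_gt0// divr_gt0// expR_gt0.
exists (a / (a + 1) * m / 8); split.
  by rewrite divr_gt0// mulr_gt0// divr_gt0//; lra.
move=> x; have x0 := enorm_ge0 x.
have ax : 0 < a + enorm x by lra.
have ax1 : 0 < a + 1 + enorm x by lra.
have c0 : 0 <= (a + 1 + enorm x)^-1 * m.
  by rewrite mulr_ge0 ?invr_ge0// ltW.
rewrite -lee_fin uE.
have := int3_ball_ge (0 : space3 R) (@ler01 R).
rewrite expr1n => /(lee_wpmul2l (x := ((a + 1 + enorm x)^-1 * m)%:E)) h.
apply: le_trans (le_trans (h _) _); last 2 first.
- by rewrite lee_fin.
- rewrite -int3Z//; last 2 first.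
  + by apply: borel3_if; [exact: borelp_ball|bor|bor].
  + by move=> z; case: ifP.
  apply: int3_le => y; first by rewrite mulr_ge0//; case: ifP.
  case: ifP => y1; last by rewrite mulr0; exact: solves_integrand_ge0.
  rewrite mulr1; apply: ler_pM; rewrite ?invr_ge0 ?(ltW ax1) ?(ltW m0)//.
    apply: le_trans (kern_ge a0 (enorm_ge0 _)).
    rewrite lef_pV2 ?posrE//; last by have := enorm_ge0 (x - y); lra.
    have := enorm_triangle x 0 y; move: y1; rewrite /ballp subr0; lra.
  apply: (ge0_ler_powR (ltW q0)); rewrite ?nnegrE ?(ltW (u0 _))//.
    by rewrite divr_ge0 ?expR_ge0// ltW.
  rewrite ler_pdivrMr ?expR_gt0// mulrC.
  apply: le_trans (solution_harnack a0 su 0 y) _.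
  apply: ler_wpM2r; first exact: ltW.
  rewrite ler_expR ler_pdivrMr// mulVf ?gt_eqF//; exact: ltW.
rewrite -EFinM lee_fin.
rewrite (_ : a / (a + 1) * m / 8 / (a + enorm x)
   = (a / (a + 1) / (a + enorm x)) * (m / 8)); last by ring.
rewrite (_ : (a + 1 + enorm x)^-1 * m * (1 / 8)
   = (a + 1 + enorm x)^-1 * (m / 8)); last by ring.
apply: ler_wpM2r; first by lra.
rewrite -mulrA -invfM ler_pdivrMr; last by rewrite mulr_gt0//; lra.
rewrite mulrC ler_pdivlMr//; nra.
Qed.

End FirstBounds.


(** * Decay at the critical rate *)

Section CriticalDecay.
Context {R : realType}.
Implicit Types (a q : R) (u : space3 R -> R) (x y : space3 R).

Lemma int3_kern_ball a : 0 < a -> exists C, 0 <= C /\ forall x r, 0 < r ->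
  (int3 (fun z => (if ballp x r z then kern a (enorm (x - z)) else 0)%R)
    <= (C * r ^+ 2)%:E)%E.
Proof.
move=> a0; have [||C [C0 H]] := @int3_near R 1; [by lra|by lra|].
exists C; split => // x r r0.
pose e := Num.min a (r / 2).
have e0 : 0 < e by rewrite lt_min a0; lra.
have er : e < r by rewrite gt_min; apply/orP; right; lra.
have := H _ x 1 r e ler01 e0 er.
rewrite mulr1 (_ : 3 - 1 = 2%:R); last by ring.
rewrite powR_mulrn ?(ltW r0)//; apply => [z|z|z|].
- by case: ifP => // _; apply/ltW/kern_gt0.
- by rewrite /ballp leNgt => /negbTE ->.
- move=> z0; rewrite mul1r powR_inv1 ?(ltW z0)//.
  by case: ifP => _; [exact: kern_le_inv|rewrite invr_ge0 ltW].
- rewrite mul1r powR_inv1 ?(ltW e0)// subrr enorm0.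
  have h : a^-1 <= e^-1 by rewrite lef_pV2// ge_min lexx.
  case: ifP => _; last by rewrite invr_ge0 ltW.
  by rewrite kern_le0.
Qed.

(** Suppose that [w = u ^ ((q - 1) / 2)] violates the bound at [x0]. On the
    ball of radius [|x0| / 2] around [x0] choose [x] almost maximizing [w]
    times the distance [d] to the boundary of the ball. Then [w <= 4 * w x] on
    the ball of radius [d x / 2] around [x], and the radius [r = t / w x] fits
    in it. The part of the integral over the ball of radius [r] is at most
    [u x / 2] by the choice of [t]; the other part varies on that ball by a
    factor of at most [4]. So [u >= u x / 8] on the ball, and the integral of
    [u ^ p] over it is at least the constant [m], which depends neither on [x]
    nor on [x0]. But the ball lies outside of the ball of radius [|x0| / 2]
    around the origin. *)
Lemma solution_critical_decay a q u : 0 < a -> 1 < q -> solves a q u ->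
  (int3 (fun x => (u x `^ (3 * (q - 1) / 2))%R) < +oo)%E ->
  forall e, 0 < e -> exists rho, 0 < rho /\
    forall x, rho <= enorm x -> u x `^ ((q - 1) / 2) * enorm x <= e.
Proof.
move=> a0 q1 su; have [mu u0 uE] := su.
set p := 3 * (q - 1) / 2 => fin e e0; set b := (q - 1) / 2.
have b0 : 0 < b by rewrite /b; lra.
have p0 : 0 < p by rewrite /p; lra.
have pb : p = b * 3 by rewrite /p /b; field.
have up0 y : 0 <= u y `^ p by exact: powR_ge0.
have [M [M0 uM]] := solution_bounded a0 p0 su fin.
have [C [C0 CH]] := int3_kern_ball a0.
pose A : R := 4 `^ b^-1.
have A0 : 0 < A by rewrite powR_gt0.
pose K := 32 * A * C.
have K0 : 0 <= K by rewrite !mulr_ge0// ltW.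
(* the first bound makes the ball fit, the second makes the near part small *)
pose t := Num.min (e / 8) (K + 1)^-1.
have t0 : 0 < t by rewrite lt_min divr_gt0//= invr_gt0; lra.
have te : t <= e / 8 by rewrite ge_min lexx.
have tK : K * t ^+ 2 <= 1.
  have h1 : t <= (K + 1)^-1 by rewrite ge_min lexx orbT.
  have h2 : (K + 1) * t <= 1.
    by rewrite mulrC -ler_pdivlMr ?div1r//; lra.
  have h3 : t <= 1 by nra.
  have h4 : K * t <= 1 by lra.
  have : K * t * t <= 1 * t by apply: ler_wpM2r => //; lra.
  by rewrite expr2; lra.
pose m := (8^-1 `^ b) ^+ 3 * t ^+ 3 / 8.
have m0 : 0 < m.
  by rewrite divr_gt0// mulr_gt0// exprn_gt0// powR_gt0.
have [|rho [rho0 tail]] := int3_tail _ up0 fin (divr_gt0 m0 (ltr0n R 2)).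
  by bor.
exists (2 * rho); split; first by lra.
move=> x0 x0r; set L := enorm x0 in x0r *.
have L0 : 0 < L by lra.
rewrite leNgt; apply/negP => contra.
pose w y := u y `^ b.
have w0 y : 0 < w y by rewrite powR_gt0.
pose d y := L / 2 - enorm (x0 - y).
pose E := [set s | exists y, 0 < d y /\ s = d y * w y].
have dx0 : d x0 = L / 2 by rewrite /d subrr enorm0 subr0.
have supE : has_sup E.
  split; first by exists (d x0 * w x0); exists x0; split => //; rewrite dx0; lra.
  exists (L / 2 * M `^ b) => _ [y [dy ->]].
  apply: ler_pM; [exact: ltW|exact: ltW| |].
    by rewrite /d; have := enorm_ge0 (x0 - y); lra.
  by apply: (ge0_ler_powR (ltW b0)); rewrite ?nnegrE// ltW.
have S1 : e / 2 < sup E.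
  apply: (@lt_le_trans _ _ (d x0 * w x0)).
    by rewrite dx0; move: contra; rewrite -/(w x0); lra.
  apply: ub_le_sup; first by case: supE.
  by exists x0; split => //; rewrite dx0; lra.
have [_ [x [dx ->]] xS] : exists2 s, E s & sup E - sup E / 2 < s.
  by apply: sup_adherent => //; lra.
have {}xS : sup E / 2 < d x * w x by lra.
have wx0 := w0 x.
set s := w x in xS wx0.
have near_w y : enorm (x - y) < d x / 2 -> w y <= 4 * s.
  move=> xy; have dy : d x / 2 < d y.
    by have := enorm_triangle x0 x y; rewrite /d; move: xy; rewrite /d; lra.
  have dy0 : 0 < d y by lra.
  have h : d y * w y <= sup E.
    by apply: ub_le_sup; [case: supE|exists y].
  have h2 : d x / 2 * w y <= d y * w y.
    by apply: ler_wpM2r; [exact/ltW/w0|exact: ltW].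
  have h3 : d x * w y <= d x * (4 * s) by lra.
  by move: h3; rewrite ler_pM2l.
pose r := t / s.
have r0 : 0 < r by rewrite divr_gt0.
have rs : r * s = t by rewrite /r mulfVK// gt_eqF.
have rd : r <= d x / 2.
  have : r * s <= d x / 2 * s by rewrite rs; lra.
  by rewrite ler_pM2r.
have uw y : u y `^ q = u y * w y ^+ 2.
  rewrite -powR_mulrn ?powR_ge0// -powRrM.
  rewrite -{2}(powRr1 (ltW (u0 y))) -powRD; last first.
    by rewrite (gt_eqF (u0 y)) implybT.
  by congr (_ `^ _); rewrite /b; field.
have wu y z (k : R) : 0 < k -> w y <= k * w z -> u y <= k `^ b^-1 * u z.
  move=> k0 h.
  have -> : k `^ b^-1 * u z = (k * w z) `^ b^-1.
    rewrite powRM ?(ltW k0) ?(ltW (w0 z))// /w -powRrM mulfV ?gt_eqF//.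
    by rewrite powRr1// ltW.
  apply: powR_le_inv => //; [exact: ltW|].
  by rewrite mulr_ge0 ?(ltW k0) ?(ltW (w0 z)).
have near_uq y : ballp x r y -> u y `^ q <= 16 * A * u x * s ^+ 2.
  rewrite /ballp => xy; have wy : w y <= 4 * s by apply: near_w; lra.
  have uy : u y <= A * u x by exact: wu.
  have wy2 : w y ^+ 2 <= (4 * s) ^+ 2.
    by rewrite ler_pXn2r ?nnegrE ?mulr_ge0 ?(ltW (w0 _))// ltW.
  rewrite uw; apply: le_trans (ler_pM _ _ uy wy2) _.
  - exact: ltW.
  - by rewrite exprn_ge0// ltW.
  by rewrite exprMn; lra.
pose near z := if ballp x r z then kern a (enorm (x - z)) * u z `^ q else 0.
pose far z := if ballp x r z then 0 else kern a (enorm (x - z)) * u z `^ q.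
have kg0 y z : 0 <= kern a (enorm (y - z)) by exact/ltW/kern_gt0.
have far0 z : 0 <= far z by rewrite /far; case: ifP => // _; rewrite mulr_ge0 ?powR_ge0.
have near0 z : 0 <= near z by rewrite /near; case: ifP => // _; rewrite mulr_ge0 ?powR_ge0.
have bI := solves_borel_integrand q x a0 mu.
have bnear : borel3 near.
  by apply: borel3_if => //; [exact: borelp_ball|exact: borel3_cst].
have bfar : borel3 far.
  by apply: borel3_if => //; [exact: borelp_ball|exact: borel3_cst].
have usplit : (u x)%:E = (int3 near + int3 far)%E.
  rewrite uE -int3D//; apply: eq_int3 => z; rewrite /near /far.
  by case: ifP => _; rewrite ?addr0 ?add0r.
have near_le : (int3 near <= (u x / 2)%:E)%E.
  pose c := 16 * A * u x * s ^+ 2.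
  have c0 : 0 <= c.
    by rewrite /c mulr_ge0 ?sqr_ge0// mulr_ge0 ?(ltW (u0 x))// mulr_ge0// ltW.
  apply: (@le_trans _ _ (c%:E * (C * r ^+ 2)%:E)%E).
    apply: le_trans (lee_wpmul2l _ (CH x r r0)); last by rewrite lee_fin.
    rewrite -int3Z//; last 2 first.
    - by apply: borel3_if; [exact: borelp_ball|exact: borel3_kerns|bor].
    - by move=> z; case: ifP.
    apply: int3_le => // z; rewrite /near; case: ifP => xz; last by rewrite mulr0.
    rewrite mulrC; apply: ler_wpM2r => //; exact: near_uq.
  rewrite -EFinM lee_fin /c.
  have -> : 16 * A * u x * s ^+ 2 * (C * r ^+ 2) = u x / 2 * (K * (r * s) ^+ 2).
    by rewrite /K; field.
  rewrite rs; have ux := ltW (u0 x).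
  by rewrite -[leRHS]mulr1; apply: ler_wpM2l => //; lra.
have far_ge : ((u x / 2)%:E <= int3 far)%E.
  have ffar : (int3 far <= (u x)%:E)%E.
    by rewrite usplit leeDr// int3_ge0.
  have fnear : (int3 near <= (u x)%:E)%E.
    by rewrite usplit leeDl// int3_ge0.
  have [Jn [Jn0 JnE]] := int3_fin near0 (le_lt_trans fnear (ltry _)).
  have [Jf [Jf0 JfE]] := int3_fin far0 (le_lt_trans ffar (ltry _)).
  move: usplit near_le; rewrite JnE JfE -EFinD !lee_fin => -[->]; lra.
have low_u y : ballp x r y -> u x / 8 <= u y.
  rewrite /ballp => xy.
  have : (int3 far <= 4%:E * (u y)%:E)%E.
    rewrite uE -int3Z//; last 2 first.
    - exact: solves_borel_integrand.
    - exact: solves_integrand_ge0.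
    apply: int3_le => // z; rewrite /far; case: ifPn => xz.
      by rewrite !mulr_ge0 ?powR_ge0.
    rewrite mulrA; apply: ler_wpM2r; first exact: powR_ge0.
    apply: kern_double => //; first exact: enorm_ge0.
    move: xz; rewrite /ballp -leNgt => xz.
    have := enorm_triangle y x z; rewrite (enormC y x); lra.
  by move=> /(le_trans far_ge); rewrite -EFinM lee_fin; lra.
have wp y : u y `^ p = w y ^+ 3.
  by rewrite -powR_mulrn ?powR_ge0// -powRrM pb.
have low_p y : ballp x r y -> (8^-1 `^ b) ^+ 3 * s ^+ 3 <= u y `^ p.
  move=> /low_u h; rewrite wp -exprMn ler_pXn2r ?nnegrE ?(ltW (w0 y))//; last first.
    by rewrite mulr_ge0 ?powR_ge0// ltW.
  rewrite /s /w -powRM ?(ltW (u0 x))//.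
  apply: (ge0_ler_powR (ltW b0)); rewrite ?nnegrE ?(ltW (u0 y))//.
    by rewrite mulr_ge0// ltW.
  by rewrite mulrC.
have c0 : 0 <= (8^-1 `^ b) ^+ 3 * s ^+ 3.
  by rewrite mulr_ge0 ?exprn_ge0 ?powR_ge0// ltW.
have : (m%:E <= (m / 2)%:E)%E.
  apply: le_trans tail.
  apply: (@le_trans _ _ (((8^-1 `^ b) ^+ 3 * s ^+ 3)%:E * (r ^+ 3 / 8)%:E)%E).
    rewrite -EFinM lee_fin /m -rs exprMn; lra.
  apply: le_trans (lee_wpmul2l _ (int3_ball_ge x (ltW r0))) _.
    by rewrite lee_fin.
  rewrite -int3Z//; last 2 first.
  - by apply: borel3_if; [exact: borelp_ball|bor|bor].
  - by move=> z; case: ifP.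
  apply: int3_le => y; first by rewrite mulr_ge0//; case: ifP.
  case: ifP => xy; last by rewrite mulr0; case: ifP.
  rewrite mulr1 ifT; first exact: low_p.
  move: xy; rewrite /ballp => xy.
  have := enorm_triangle x0 x y; have := enormD (x0 - y) y; rewrite subrK -/L.
  by move: rd; rewrite /d in dx *; lra.
by rewrite lee_fin; lra.
Qed.

End CriticalDecay.


(** * Decay at the rate of the kernel *)

Section Decay.
Context {R : realType}.
Implicit Types (a q : R) (u : space3 R -> R) (x y : space3 R).

Lemma enorm_axis (t : R) : 0 <= t -> enorm (t, 0, 0) = t.
Proof.
by move=> t0; rewrite /enorm /= expr0n /= !addr0 sqrtr_sqr ger0_norm.
Qed.

(** [u] is at least of order [1 / |x|] and is [o(|x| ^ (- 2 / (q - 1)))], so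
    that [2 / (q - 1) < 1]. *)
Lemma supercritical a q u : 0 < a -> 1 < q -> solves a q u ->
  (int3 (fun x => (u x `^ (3 * (q - 1) / 2))%R) < +oo)%E -> 3 < q.
Proof.
move=> a0 q1 su fin; have [mu u0 uE] := su.
have [c [c0 low]] := solution_lower a0 (lt_trans ltr01 q1) su.
have c4 : 0 < c / 4 by lra.
have [rho [rho0 H]] := solution_critical_decay a0 q1 su fin c4.
rewrite ltNge; apply/negP => q3.
pose t := rho + a + c; pose x : space3 R := (t, 0, 0).
have t0 : 0 < t by rewrite /t; lra.
have xt : enorm x = t by rewrite enorm_axis// ltW.
have := H x; rewrite xt => /(_ _)/wrap[]; first by rewrite /t; lra.
have := low x; rewrite xt => lowx.
have at0 : 0 < a + t by lra.
set b := (q - 1) / 2.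
have b0 : 0 <= b by rewrite /b; lra.
have b1 : b <= 1 by rewrite /b; lra.
have l0 : 0 < c / (a + t) by rewrite divr_gt0.
have l1 : c / (a + t) <= 1 by rewrite ler_pdivrMr// mul1r /t; lra.
have h1 : c / (a + t) <= u x `^ b.
  apply: (@le_trans _ _ ((c / (a + t)) `^ b)).
    rewrite -[leLHS](powRr1 (ltW l0)); apply: ger_powR => //.
    by rewrite l0.
  by apply: (ge0_ler_powR b0); rewrite ?nnegrE ?(ltW (u0 _))// ltW.
have h2 : c / 2 <= c / (a + t) * t.
  by rewrite mulrAC ler_pdivlMr// /t; nra.
have h3 : c / (a + t) * t <= u x `^ b * t by apply: ler_wpM2r => //; exact: ltW.
lra.
Qed.

Lemma powR_half (t s : R) : 0 <= t -> (t / 2) `^ (- s) = 2 `^ s * t `^ (- s).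
Proof.
move=> t0; rewrite powRM ?invr_ge0// mulrC; congr (_ * _).
by rewrite -powR_inv1// -powRrM mulN1r opprK.
Qed.

(** Three regions: near the origin the kernel is at most [2 / |x|], near [x]
    the power is at most that of [|x| / 2], and elsewhere [|x - z|] is at least
    [|z| / 3]. The exponents [2 + b < 3 < 3 + b] make all integrals
    converge. *)
Lemma riesz_estimate a (b : R) : 0 < a -> 0 < b -> b < 1 ->
  exists C, 0 <= C /\ forall x, x != 0 ->
  (int3 (fun z => (kern a (enorm (x - z)) * enorm z `^ (- (2 + b)))%R)
    <= (C * enorm x `^ (- b))%:E)%E.
Proof.
move=> a0 b0 b1.
have [||C1 [C10 H1]] := @int3_near R (2 + b); [by lra|by lra|].
have [C2 [C20 H2]] := int3_kern_ball a0.
have [|C3 [C30 H3]] := @int3_far R (3 + b); first by lra.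
exists ((C1 + C2 + 3 * C3) * 2 `^ b); split.
  by rewrite mulr_ge0 ?powR_ge0//; lra.
move=> x x0; have t0 := enorm_gt0 x0; set t := enorm x in t0 *.
pose r := t / 2; have r0 : 0 < r by rewrite /r; lra.
have kg0 z : 0 <= kern a (enorm (x - z)) by exact/ltW/kern_gt0.
pose fA z := if ballp 0 r z then 2 / t * enorm z `^ (- (2 + b)) else 0.
pose fB z := r `^ (- (2 + b)) * (if ballp x r z then kern a (enorm (x - z)) else 0).
pose fC z := if ballp 0 r z then 0 else 3 * enorm z `^ (- (3 + b)).
have fA0 z : 0 <= fA z.
  by rewrite /fA; case: ifP => // _; rewrite mulr_ge0 ?powR_ge0// divr_ge0// ltW.
have fB0 z : 0 <= fB z.
  by rewrite /fB mulr_ge0 ?powR_ge0//; case: ifP.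
have fC0 z : 0 <= fC z.
  by rewrite /fC; case: ifP => // _; rewrite mulr_ge0 ?powR_ge0.
have bA : borel3 fA.
  by apply: borel3_if; [exact: borelp_ball|bor|bor].
have bB0 : borel3 (fun z => if ballp x r z then kern a (enorm (x - z)) else 0).
  by apply: borel3_if; [exact: borelp_ball|exact: borel3_kerns|bor].
have bB : borel3 fB by apply: borel3M => //; exact: borel3_cst.
have bC : borel3 fC.
  by apply: borel3_if; [exact: borelp_ball|bor|bor].
have e0z z : enorm (0 - z) = enorm z by rewrite sub0r enormN.
have rb : r `^ (- b) = 2 `^ b * t `^ (- b) by rewrite /r powR_half// ltW.
have IA : (int3 fA <= (C1 * r `^ (- b))%:E)%E.
  have D0 : 0 <= 2 / t by rewrite divr_ge0// ltW.
  have e0 : 0 < r / 2 by lra.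
  have er : r / 2 < r by lra.
  apply: le_trans (H1 fA 0 (2 / t) r (r / 2) D0 e0 er fA0 _ _ _) _.
  - by move=> z; rewrite /fA /ballp leNgt => /negbTE ->.
  - move=> z z0; rewrite /fA e0z; case: ifP => // _.
    by rewrite mulr_ge0 ?powR_ge0.
  - rewrite /fA enorm0 powR0 ?mulr0; last by rewrite oppr_eq0 gt_eqF//; lra.
    by rewrite if_same mulr_ge0 ?powR_ge0.
  rewrite lee_fin -mulrA; apply: ler_wpM2l => //.
  have -> : 3 - (2 + b) = 1 + - b by ring.
  rewrite powRD; last by rewrite (gt_eqF r0) implybT.
  rewrite powRr1 ?(ltW r0)// mulrA /r.
  by have -> : 2 / t * (t / 2) = 1; [field; rewrite gt_eqF|rewrite mul1r].
have IB : (int3 fB <= (C2 * r `^ (- b))%:E)%E.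
  rewrite /fB int3Z ?powR_ge0//; last by move=> z; case: ifP.
  apply: le_trans (lee_wpmul2l _ (H2 x r r0)) _; first by rewrite lee_fin powR_ge0.
  rewrite -EFinM lee_fin mulrCA; apply: ler_wpM2l => //.
  rewrite -powR_mulrn ?(ltW r0)// -powRD; last by rewrite (gt_eqF r0) implybT.
  by rewrite le_eqVlt; apply/orP; left; apply/eqP; congr (_ `^ _); ring.
have IC : (int3 fC <= (C3 * 3 * r `^ (- b))%:E)%E.
  have D0 : 0 <= 3 :> R by [].
  have := H3 fC 0 3 r D0 r0 fC0.
  have -> : 3 - (3 + b) = - b by ring.
  apply => z; rewrite /fC /ballp; first by move=> ->.
  by rewrite leNgt => /negbTE ->; rewrite e0z.
apply: (@le_trans _ _ (int3 (fun z => (fA z + fB z + fC z)%R))%E).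
  apply: int3_le => z; first by rewrite mulr_ge0 ?powR_ge0.
  clear C1 C10 H1 C2 C20 H2 C3 C30 H3 IA IB IC rb.
  have pz := powR_ge0 (enorm z) (- (2 + b)).
  have pz3 := powR_ge0 (enorm z) (- (3 + b)).
  have := fA0 z; have := fB0 z; have := fC0 z.
  rewrite {2}/fA {2}/fC /ballp e0z; case: ltP => zr hC hB hA.
    have tz : r < enorm (x - z).
      by have := enormD (x - z) z; rewrite subrK -/t; move: zr; rewrite /r; lra.
    have z0 : 0 < enorm (x - z) by lra.
    have h : kern a (enorm (x - z)) <= 2 / t.
      apply: le_trans (kern_le_inv a z0) _.
      have -> : 2 / t = r^-1 by rewrite /r; field; rewrite gt_eqF.
      by rewrite lef_pV2 ?posrE//; exact: ltW.
    by have := ler_wpM2r pz h; lra.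
  have [h|h] := ltP (enorm (x - z)) r.
    have fBE : fB z = r `^ (- (2 + b)) * kern a (enorm (x - z)).
      by rewrite /fB /ballp h.
    have h2 : enorm z `^ (- (2 + b)) <= r `^ (- (2 + b)).
      by apply: powR_anti => //; lra.
    by have := ler_wpM2l (kg0 z) h2; lra.
  have xz0 : 0 < enorm (x - z) by lra.
  have z0 : 0 < enorm z by lra.
  have z3 : enorm z <= 3 * enorm (x - z).
    have := enorm_triangle z x 0; rewrite !subr0 (enormC z x) -/t.
    by move: h; rewrite /r; lra.
  have zE : enorm z `^ (- (3 + b)) = (enorm z)^-1 * enorm z `^ (- (2 + b)).
    rewrite -powR_inv1 ?(ltW z0)// -powRD; last by rewrite (gt_eqF z0) implybT.
    by congr (_ `^ _); ring.
  have h3 : kern a (enorm (x - z)) <= 3 * (enorm z)^-1.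
    apply: le_trans (kern_le_inv a xz0) _.
    by rewrite ler_pdivlMr// mulrC ler_pdivrMr.
  by have := ler_wpM2r pz h3; rewrite zE; lra.
rewrite int3D//; last 2 first.
- exact: borel3D.
- by move=> z; rewrite addr_ge0.
rewrite int3D//.
apply: le_trans (leeD (leeD IA IB) IC) _.
rewrite -!EFinD lee_fin rb le_eqVlt; apply/orP; left; apply/eqP; ring.
Qed.

Lemma inv_le_powR a (b t : R) : 0 < a -> 0 <= b <= 1 -> 0 < t ->
  (a + t)^-1 <= a `^ (b - 1) * t `^ (- b).
Proof.
move=> a0 /andP[b0 b1] t0; have at0 : 0 < a + t by lra.
rewrite -powR_inv1 ?(ltW at0)//.
have -> : b - 1 = - (1 - b) by ring.
have -> : -1 = (- (1 - b)) + - b by ring.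
rewrite powRD; last by rewrite (gt_eqF at0) implybT.
by apply: ler_pM; rewrite ?powR_ge0//; apply: powR_anti; lra.
Qed.

End Decay.


Section Bootstrap.
Context {R : realType}.
Implicit Types (a q : R) (u : space3 R -> R) (x y : space3 R).

(** A source supported in a ball acts from far away like a point mass. *)
Lemma near_source_bound a q u (M rho : R) : 0 < a -> 0 < q -> 0 < rho ->
  solves a q u -> (forall x, u x <= M) -> exists G, 0 <= G /\ forall x,
  (int3 (fun z => (if enorm z < rho then kern a (enorm (x - z)) * u z `^ q
    else 0)%R) <= (G / (a + enorm x))%:E)%E.
Proof.
move=> a0 q0 rho0 su uM; have [mu u0 uE] := su.
have M0 : 0 < M := lt_le_trans (u0 0) (uM 0).
pose c := 2 * (1 + rho / a) * M `^ q.
have ra : 0 < rho / a by rewrite divr_gt0.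
have c0 : 0 <= c by rewrite /c mulr_ge0 ?powR_ge0//; lra.
exists (c * (8 * rho ^+ 3)); split.
  by rewrite mulr_ge0// mulr_ge0// exprn_ge0// ltW.
move=> x; have x0 := enorm_ge0 x; have ax : 0 < a + enorm x by lra.
have d0 : 0 <= c / (a + enorm x) by rewrite divr_ge0// ltW.
rewrite mulrAC EFinM.
apply: le_trans (lee_wpmul2l _ (int3_ball_le 0 (ltW rho0))); last first.
  by rewrite lee_fin.
rewrite -int3Z//; last 2 first.
- by apply: borel3_if; [exact: borelp_ball|bor|bor].
- by move=> z; case: ifP.
apply: int3_le => z.
  by case: ifP => // _; rewrite mulr_ge0 ?powR_ge0//; exact/ltW/kern_gt0.
rewrite /ballp sub0r enormN; case: ifP => zr; last by rewrite mulr0.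
have xz := enorm_ge0 (x - z); have axz : 0 < a + enorm (x - z) by lra.
have uq : u z `^ q <= M `^ q.
  by apply: (ge0_ler_powR (ltW q0)); rewrite ?nnegrE// ltW.
rewrite mulr1 /c mulrAC; apply: ler_pM; rewrite ?powR_ge0//.
  exact/ltW/kern_gt0.
apply: le_trans (kern_le2 a0 xz) _.
rewrite ler_pdivrMr// mulrAC ler_pdivlMr// -mulrA; apply: ler_wpM2l => //.
have tri := enormD (x - z) z; rewrite subrK in tri.
have e1 : (1 + rho / a) * (a + enorm (x - z))
    = a + enorm (x - z) + rho + rho / a * enorm (x - z).
  by field; rewrite gt_eqF.
have : 0 <= rho / a * enorm (x - z) by rewrite mulr_ge0// ltW.
by rewrite e1; lra.
Qed.

(** Outside of a ball [u ^ (q - 1) <= e * |z| ^ -2] with [e] small, so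
    [u <= g + T u] where [g] is the contribution of the ball and [T] maps
    [|z| ^ - b] and [|z| ^ - al], with [al = 2 / (q - 1)], to at most half of
    themselves. Critical decay gives [u <= D * |z| ^ - al]; hence the supremum
    [S] of [u / (|z| ^ - b + d * |z| ^ - al)] is finite for [d > 0] and
    satisfies [S <= G' + S / 2]. The resulting bound does not depend on [d],
    which can tend to [0]. *)
Lemma solution_decay_powR a q u : 0 < a -> 1 < q -> solves a q u ->
  (int3 (fun x => (u x `^ (3 * (q - 1) / 2))%R) < +oo)%E ->
  forall b, 0 < b -> b < 1 ->
  exists C, 0 <= C /\ forall x, x != 0 -> u x <= C * enorm x `^ (- b).
Proof.
move=> a0 q1 su fin b b0 b1; have [mu u0 uE] := su.
have q3 := supercritical a0 q1 su fin.
have q0 : 0 < q by lra.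
have p0 : 0 < 3 * (q - 1) / 2 by lra.
have [M [M0 uM]] := solution_bounded a0 p0 su fin.
set k := (q - 1) / 2.
have k1 : 1 < k by rewrite /k; lra.
pose al := k^-1.
have al0 : 0 < al by rewrite invr_gt0; lra.
have al1 : al < 1 by rewrite invf_lt1//; lra.
have [Ca [Ca0 HCa]] := riesz_estimate a0 al0 al1.
have [Cb [Cb0 HCb]] := riesz_estimate a0 b0 b1.
(* [e <= 1] is used as [e ^+ 2 <= e] *)
pose e := Num.min 1 (2 * (Ca + Cb + 1))^-1.
have S0 : 0 < 2 * (Ca + Cb + 1) by lra.
have e0 : 0 < e by rewrite lt_min ltr01/= invr_gt0.
have e1 : e <= 1 by rewrite ge_min lexx.
have eS : e * (2 * (Ca + Cb + 1)) <= 1.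
  by rewrite -ler_pdivlMr// div1r ge_min lexx orbT.
have eCa : e * Ca <= 2^-1 by have := mulr_ge0 (ltW e0) Cb0; lra.
have eCb : e * Cb <= 2^-1 by have := mulr_ge0 (ltW e0) Ca0; lra.
have [rho [rho0 crit]] := solution_critical_decay a0 q1 su fin e0.
have [G [G0 HG]] := near_source_bound a0 q0 rho0 su uM.
pose G' := G * a `^ (b - 1).
have G'0 : 0 <= G' by rewrite mulr_ge0 ?powR_ge0.
have k0 : 0 < k by lra.
have ua : exists D, 0 <= D /\ forall x, x != 0 -> u x <= D * enorm x `^ (- al).
  exists (1 + M * rho `^ al); split.
    by rewrite addr_ge0// mulr_ge0 ?powR_ge0// ltW.
  move=> x /enorm_gt0 x0.
  have px := powR_ge0 (enorm x) (- al).
  have [h|h] := leP rho (enorm x).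
    have h1 : u x <= (enorm x)^-1 `^ al.
      apply: powR_le_inv => //; [exact: ltW|by rewrite invr_ge0 ltW|].
      rewrite -div1r ler_pdivlMr//; exact: le_trans (crit x h) e1.
    rewrite -powR_inv1 ?(ltW x0)// -powRrM mulN1r in h1.
    have : 0 <= M * rho `^ al * enorm x `^ (- al).
      by rewrite !mulr_ge0 ?powR_ge0// ltW.
    lra.
  have h1 : 1 <= rho `^ al * enorm x `^ (- al).
    rewrite -[leLHS](powRNM al x0) mulrC; apply: ler_wpM2r => //.
    apply: (ge0_ler_powR (ltW al0)); rewrite ?nnegrE ?(ltW x0) ?(ltW rho0)//.
    exact: ltW.
  have h2 := ler_wpM2l (ltW M0) h1; have := uM x; lra.
have [D [D0 uD]] := ua.
suff key d : 0 < d -> forall x, x != 0 ->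
    u x <= 2 * G' * (enorm x `^ (- b) + d * enorm x `^ (- al)).
  exists (2 * G'); split; first by rewrite mulr_ge0.
  move=> x x0; rewrite leNgt; apply/negP => lt.
  have pa : 0 <= enorm x `^ (- al) by exact: powR_ge0.
  pose gap := u x - 2 * G' * enorm x `^ (- b).
  have gap0 : 0 < gap by rewrite /gap; lra.
  pose F := 2 * G' * enorm x `^ (- al) + 1.
  have F0 : 0 < F by rewrite /F; have := mulr_ge0 G'0 pa; lra.
  pose d := gap / (2 * F).
  have d0 : 0 < d by rewrite divr_gt0//; lra.
  have := key d d0 x x0.
  have dF : d * F = gap / 2 by rewrite /d; field; rewrite gt_eqF.
  have : 2 * G' * (enorm x `^ (- b) + d * enorm x `^ (- al))
    = 2 * G' * enorm x `^ (- b) + d * F - d by rewrite /F; ring.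
  move=> ->; rewrite dF /gap; move: gap0; rewrite /gap; lra.
move=> d0; pose w x := enorm x `^ (- b) + d * enorm x `^ (- al).
have w0 x : x != 0 -> 0 < w x.
  by move=> /enorm_gt0 x0; rewrite addr_gt0 ?mulr_gt0 ?powR_gt0.
pose E := [set s | exists x, x != 0 /\ s = u x / w x].
have x1 : ((1, 0, 0) : space3 R) != 0.
  by apply/eqP => -[h]; have := oner_neq0 R; rewrite h eqxx.
have supE : has_sup E.
  split; first by exists (u (1, 0, 0) / w (1, 0, 0)); exists (1, 0, 0).
  exists (D / d) => _ [x [x0 ->]].
  rewrite ler_pdivrMr ?w0//; apply: le_trans (uD x x0) _.
  rewrite /w mulrDr mulrA mulfVK ?gt_eqF//; apply: ler_wpDl => //.
  by rewrite mulr_ge0 ?powR_ge0// divr_ge0// ltW.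
set S := sup E.
have uS x : x != 0 -> u x <= S * w x.
  move=> x0; rewrite -ler_pdivrMr ?w0//.
  by apply: ub_le_sup; [case: supE|exists x].
have S_ge0 : 0 <= S.
  by have := uS _ x1; have := u0 (1, 0, 0); have := w0 _ x1; nra.
have step x : x != 0 -> u x <= (G' + S / 2) * w x.
  move=> x0; have xp := enorm_gt0 x0.
  pose nr z := if enorm z < rho then kern a (enorm (x - z)) * u z `^ q else 0.
  pose ka z := kern a (enorm (x - z)) * enorm z `^ (- (2 + al)).
  pose kb z := kern a (enorm (x - z)) * enorm z `^ (- (2 + b)).
  have kg0 z : 0 <= kern a (enorm (x - z)) by exact/ltW/kern_gt0.
  have ka0 z : 0 <= ka z by rewrite mulr_ge0 ?powR_ge0.
  have kb0 z : 0 <= kb z by rewrite mulr_ge0 ?powR_ge0.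
  have nr0 z : 0 <= nr z.
    by rewrite /nr; case: ifP => // _; rewrite mulr_ge0 ?powR_ge0.
  have bk := borel3_kerns x a0.
  have bka : borel3 ka by apply: borel3M => //; bor.
  have bkb : borel3 kb by apply: borel3M => //; bor.
  have bnr : borel3 nr.
    apply: borel3_if; [by bor|exact: solves_borel_integrand|by bor].
  have eS0 : 0 <= e * S by rewrite mulr_ge0// ltW.
  have deS0 : 0 <= e * S * d by rewrite mulr_ge0// ltW.
  have ptw z : kern a (enorm (x - z)) * u z `^ q
      <= nr z + (e * S * kb z + e * S * d * ka z).
    have h0 : 0 <= e * S * kb z by rewrite mulr_ge0.
    have h1 : 0 <= e * S * d * ka z by rewrite mulr_ge0.
    clear eS eCa eCb S0 Ca0 HCa Cb0 HCb HG D0 uD G0 G'0 supE x1.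
    rewrite /nr; case: ltP => zr; first lra.
    have z0 : 0 < enorm z by lra.
    have zn : z != 0 by apply/eqP => z0'; move: z0; rewrite z0' enorm0 ltxx.
    have uq : u z `^ q <= e * enorm z `^ (- 2) * u z.
      have uk := powR_ge0 (u z) k.
      have h2 : u z `^ k <= e / enorm z by rewrite ler_pdivlMr//; exact: crit.
      have h3 : (u z `^ k) ^+ 2 <= (e / enorm z) ^+ 2.
        by rewrite ler_pXn2r ?nnegrE ?divr_ge0// ltW.
      have -> : u z `^ q = (u z `^ k) ^+ 2 * u z.
        rewrite -powR_mulrn// -powRrM -{3}(powRr1 (ltW (u0 z))) -powRD.
          by congr (_ `^ _); rewrite /k; field.
        by rewrite (gt_eqF (u0 z)) implybT.
      apply: ler_wpM2r; first exact: ltW.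
      apply: le_trans h3 _; rewrite powR_invn ?(ltW z0)// exprMn exprVn.
      apply: ler_wpM2r; first by rewrite invr_ge0 exprn_ge0// ltW.
      by rewrite expr2; have := ler_wpM2l (ltW e0) e1; lra.
    have z2 : 0 <= e * enorm z `^ (- 2) by rewrite mulr_ge0 ?powR_ge0// ltW.
    have h4 := le_trans uq (ler_wpM2l z2 (uS z zn)).
    have h5 := ler_wpM2l (kg0 z) h4.
    rewrite add0r; apply: le_trans h5 _.
    have eb (c : R) : enorm z `^ (- (2 + c)) = enorm z `^ (- 2) * enorm z `^ (- c).
      by rewrite opprD powRD// (gt_eqF z0) implybT.
    by rewrite /kb /ka /w !eb le_eqVlt; apply/orP; left; apply/eqP; ring.
  have main : (int3 nr + ((e * S)%:E * int3 kb + (e * S * d)%:E * int3 ka)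
      <= (G / (a + enorm x))%:E + ((e * S)%:E * (Cb * enorm x `^ (- b))%:E
        + (e * S * d)%:E * (Ca * enorm x `^ (- al))%:E))%E.
    apply: leeD; first exact: HG.
    by apply: leeD; apply: lee_wpmul2l; rewrite ?lee_fin//; [exact: HCb|exact: HCa].
  have {main} : ((u x)%:E <= (G / (a + enorm x))%:E
      + ((e * S)%:E * (Cb * enorm x `^ (- b))%:E
        + (e * S * d)%:E * (Ca * enorm x `^ (- al))%:E))%E.
    apply: le_trans main; rewrite uE.
    have m1 : borel3 (fun z => e * S * kb z) by apply: borel3M => //; bor.
    have m2 : borel3 (fun z => e * S * d * ka z) by apply: borel3M => //; bor.
    have n1 z : 0 <= e * S * kb z by rewrite mulr_ge0.
    have n2 z : 0 <= e * S * d * ka z by rewrite mulr_ge0.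
    rewrite -(int3Z bkb eS0 kb0) -(int3Z bka deS0 ka0) -(int3D m1 m2 n1 n2).
    rewrite -(int3D bnr (borel3D m1 m2) nr0 (fun z => addr_ge0 (n1 z) (n2 z))).
    by apply: int3_le => // z; exact: solves_integrand_ge0.
  rewrite -!EFinM -!EFinD lee_fin => /le_trans; apply.
  have pb := powR_ge0 (enorm x) (- b); have pa := powR_ge0 (enorm x) (- al).
  have h1 : G / (a + enorm x) <= G' * enorm x `^ (- b).
    rewrite /G' -mulrA; apply: ler_wpM2l => //; apply: inv_le_powR => //.
    by rewrite (ltW b0) (ltW b1).
  have h2 : e * S * (Cb * enorm x `^ (- b)) <= S / 2 * enorm x `^ (- b).
    by have := ler_wpM2r (mulr_ge0 S_ge0 pb) eCb; lra.
  have h3 : e * S * d * (Ca * enorm x `^ (- al)) <= S / 2 * (d * enorm x `^ (- al)).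
    by have := ler_wpM2r (mulr_ge0 S_ge0 (mulr_ge0 (ltW d0) pa)) eCa; lra.
  have h4 := mulr_ge0 G'0 (mulr_ge0 (ltW d0) pa).
  by rewrite /w; lra.
have S_le : S <= G' + S / 2.
  apply: ge_sup; first by case: supE.
  by move=> _ [x [x0 ->]]; rewrite ler_pdivrMr ?w0//; exact: step.
move=> x x0; apply: le_trans (uS x x0) _.
by apply: ler_wpM2r; [exact/ltW/w0|lra].
Qed.

End Bootstrap.


Section SharpDecay.
Context {R : realType}.
Implicit Types (a q : R) (u : space3 R -> R) (x y : space3 R).

(** The integral over the unit ball is finite by boundedness, the rest by the
    decay. *)
Lemma int3_fin_decay (f : space3 R -> R) (A D s : R) : 3 < s -> borel3 f ->
  0 <= A -> 0 <= D -> (forall x, 0 <= f x) -> (forall x, f x <= A) ->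
  (forall x, 1 <= enorm x -> f x <= D * enorm x `^ (- s)) ->
  (int3 f < +oo)%E.
Proof.
move=> s3 mf A0 D0 f0 fA fD.
have [C [C0 H]] := int3_far s3.
pose g x := if ballp 0 1 x then 0 else f x.
have bi : borel3 (fun x => if ballp 0 1 x then (1 : R) else 0).
  by apply: borel3_if; [exact: borelp_ball|bor|bor].
have bg : borel3 g by apply: borel3_if; [exact: borelp_ball|bor|bor].
have g0 x : 0 <= g x by rewrite /g; case: ifP.
have i0 x : 0 <= (if ballp 0 1 x then (1 : R) else 0) by case: ifP.
have e0x x : enorm (0 - x) = enorm x by rewrite sub0r enormN.
have := H g 0 D 1 D0 ltr01 g0; rewrite powR1 => Hg.
apply: (@le_lt_trans _ _ (A%:E * (8 * 1 ^+ 3)%:E + (C * D * 1)%:E)%E); last first.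
  by rewrite -EFinM -EFinD ltry.
apply: (@le_trans _ _ (A%:E * int3 (fun x => if ballp 0 1 x then 1 else 0)%R
    + int3 g)%E).
  rewrite -int3Z// -int3D//; [|by apply: borel3M => //; bor
    |by move=> x; rewrite mulr_ge0].
  apply: int3_le => // x; rewrite /g; case: ifP => _.
    by rewrite mulr1 addr0.
  by rewrite mulr0 add0r.
apply: leeD.
  by apply: lee_wpmul2l; [rewrite lee_fin|exact: int3_ball_le].
apply: Hg => x; rewrite /g /ballp; first by move=> ->.
by move=> h; rewrite ltNge h /= e0x; apply: fD; rewrite -e0x.
Qed.

Lemma solution_power_integrable a q u : 0 < a -> 1 < q -> solves a q u ->
  (int3 (fun x => (u x `^ (3 * (q - 1) / 2))%R) < +oo)%E ->
  exists C s, [/\ 0 <= C, 3 < s,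
    forall x, x != 0 -> u x `^ q <= C * enorm x `^ (- s)
    & (int3 (fun x => (u x `^ q)%R) < +oo)%E].
Proof.
move=> a0 q1 su fin; have [mu u0 uE] := su.
have q3 := supercritical a0 q1 su fin.
have q0 : 0 < q by lra.
have p0 : 0 < 3 * (q - 1) / 2 by lra.
have [M [M0 uM]] := solution_bounded a0 p0 su fin.
pose b := (1 + 3 / q) / 2.
have q3' : 3 / q < 1 by rewrite ltr_pdivrMr// mul1r.
have q3'' : 0 < 3 / q by rewrite divr_gt0.
have b0 : 0 < b by rewrite /b; lra.
have b1 : b < 1 by rewrite /b; lra.
have bqE : b * q = (q + 3) / 2 by rewrite /b; field; rewrite gt_eqF.
have bq : 3 < b * q by rewrite bqE; lra.
have [C [C0 H]] := solution_decay_powR a0 q1 su fin b0 b1.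
have HC x : x != 0 -> u x `^ q <= C `^ q * enorm x `^ (- (b * q)).
  move=> x0; rewrite -mulNr powRrM -powRM ?powR_ge0//.
  apply: (ge0_ler_powR (ltW q0)); rewrite ?nnegrE ?(ltW (u0 _))//.
    by rewrite mulr_ge0 ?powR_ge0.
  exact: H.
exists (C `^ q), (b * q); split => //; first exact: powR_ge0.
apply: (int3_fin_decay (A := M `^ q) (D := C `^ q) bq) => //.
- by bor.
- exact: powR_ge0.
- exact: powR_ge0.
- by move=> x; exact: powR_ge0.
- move=> x; apply: (ge0_ler_powR (ltW q0)); rewrite ?nnegrE ?(ltW (u0 _))//.
  exact: ltW.
- move=> x x1; apply: HC; apply/eqP => x0; move: x1.
  by rewrite x0 enorm0; lra.
Qed.

(** Sources at distance at least [|x| / 2] from [x] are weighted by at most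
    [4 / (a + |x|)]; those closer to [x] are small because [u ^ q] decays
    faster than [|x| ^ -3]. *)
Lemma solution_upper a q u : 0 < a -> 1 < q -> solves a q u ->
  (int3 (fun x => (u x `^ (3 * (q - 1) / 2))%R) < +oo)%E ->
  exists C, 0 < C /\ forall x, u x <= C / (a + enorm x).
Proof.
move=> a0 q1 su fin; have [mu u0 uE] := su.
have p0 : 0 < 3 * (q - 1) / 2 by lra.
have [M [M0 uM]] := solution_bounded a0 p0 su fin.
have [D [s [D0 s3 uD qfin]]] := solution_power_integrable a0 q1 su fin.
have [I [I0 IE]] := int3_fin (fun x => powR_ge0 _ _) qfin.
have [K [K0 HK]] := int3_kern_ball a0.
pose C := M * (a + 2) + 4 * I + 2 * D * K * (a + 1).
have C1 : 0 <= M * (a + 2) by rewrite mulr_ge0//; lra.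
have C2 : 0 <= 2 * D * K * (a + 1) by rewrite !mulr_ge0//; lra.
have Mpos : 0 < M * (a + 2) by rewrite mulr_gt0//; lra.
exists C; split; first by rewrite /C; lra.
move=> x; have x0 := enorm_ge0 x; set t := enorm x in x0 *.
have at0 : 0 < a + t by lra.
rewrite ler_pdivlMr//.
have [t2|t2] := ltP t 2.
  have : u x * (a + t) <= M * (a + 2).
    by apply: ler_pM => //; [exact: ltW|exact: ltW|lra].
  by rewrite /C; lra.
pose r := t / 2; have r1 : 1 <= r by rewrite /r; lra.
have r0 : 0 < r by lra.
have kg0 z : 0 <= kern a (enorm (x - z)) by exact/ltW/kern_gt0.
pose f1 z := 4 / (a + t) * u z `^ q.
pose f2 z := D * r `^ (- s) * (if ballp x r z then kern a (enorm (x - z)) else 0).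
have c1 : 0 <= 4 / (a + t) by rewrite divr_ge0// ltW.
have c2 : 0 <= D * r `^ (- s) by rewrite mulr_ge0 ?powR_ge0.
have bq : borel3 (fun z => u z `^ q) by bor.
have bk : borel3 (fun z => if ballp x r z then kern a (enorm (x - z)) else 0).
  by apply: borel3_if; [exact: borelp_ball|exact: borel3_kerns|bor].
have k0 z : 0 <= (if ballp x r z then kern a (enorm (x - z)) else 0).
  by case: ifP.
have b1 : borel3 f1 by apply: borel3M => //; bor.
have b2 : borel3 f2 by apply: borel3M => //; bor.
have f10 z : 0 <= f1 z by rewrite /f1 mulr_ge0 ?powR_ge0.
have f20 z : 0 <= f2 z by rewrite /f2 mulr_ge0.
have : ((u x)%:E <= (4 / (a + t) * I)%:E + (D * r `^ (- s) * (K * r ^+ 2))%:E)%E.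
  rewrite uE; apply: (@le_trans _ _ (int3 f1 + int3 f2)%E).
    rewrite -int3D//; apply: int3_le => z; first exact: solves_integrand_ge0.
    rewrite /f2 /ballp; case: ltP => xz.
      apply: ler_wpDl => //; rewrite mulrC; apply: ler_wpM2r => //.
      have zr : r <= enorm z.
        by have := enormD (x - z) z; rewrite subrK -/t; move: xz; rewrite /r; lra.
      have z0 : z != 0 by apply/eqP => z0; move: zr; rewrite z0 enorm0; lra.
      apply: le_trans (uD z z0) _; apply: ler_wpM2l => //.
      by apply: powR_anti => //; lra.
    rewrite mulr0 addr0; apply: ler_wpM2r; first exact: powR_ge0.
    apply: le_trans (kern_le2 a0 (enorm_ge0 _)) _.
    have xz0 := enorm_ge0 (x - z).
    rewrite ler_pdivrMr; last by lra.
    by rewrite mulrAC ler_pdivlMr//; move: xz; rewrite /r; lra.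
  rewrite /f1 /f2 !int3Z// ?IE//; last by move=> z; exact: powR_ge0.
  apply: leeD; first by rewrite -EFinM.
  by rewrite [leRHS]EFinM; apply: lee_wpmul2l; [rewrite lee_fin|exact: HK].
rewrite -EFinD lee_fin => h.
have rs : r `^ (- s) * r ^+ 2 <= r^-1.
  rewrite -powR_mulrn ?(ltW r0)// -powRD; last by rewrite (gt_eqF r0) implybT.
  by rewrite -powR_inv1 ?(ltW r0)//; apply: ler_powR => //; lra.
have h1 := ler_wpM2r (ltW at0) h.
apply: le_trans h1 _; rewrite mulrDl.
have -> : 4 / (a + t) * I * (a + t) = 4 * I by field; rewrite gt_eqF.
have h2 : D * r `^ (- s) * (K * r ^+ 2) * (a + t) <= D * K * r^-1 * (a + t).
  apply: ler_wpM2r; first exact: ltW.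
  by have := ler_wpM2l (mulr_ge0 D0 K0) rs; lra.
have h3 : r^-1 * (a + t) <= 2 * (a + 1).
  rewrite mulrC ler_pdivrMr//; have := ler_wpM2l (ltW a0) r1; rewrite /r in r1 *; lra.
have := ler_wpM2l (mulr_ge0 D0 K0) h3; rewrite /C; lra.
Qed.

End SharpDecay.

(** * Membership in Lebesgue spaces *)

Section LpSpaces.
Context {R : realType}.
Implicit Types (a q : R) (u : space3 R -> R) (x y : space3 R).

Lemma inv_pow_integrable_lt a (C s : R) u : 0 < a -> 0 < C -> 3 < s ->
  borel3 u -> (forall x, 0 <= u x) -> (forall x, u x <= C / (a + enorm x)) ->
  (int3 (fun x => (u x `^ s)%R) < +oo)%E.
Proof.
move=> a0 C0 s3 mu u0 uC.
apply: (int3_fin_decay (A := (C / a) `^ s) (D := C `^ s) s3).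
- by bor.
- exact: powR_ge0.
- exact: powR_ge0.
- by move=> x; exact: powR_ge0.
- move=> x; have x0 := enorm_ge0 x.
  apply: ge0_ler_powR; rewrite ?nnegrE ?u0//; [lra|by rewrite divr_ge0// ltW|].
  apply: le_trans (uC x) _; apply: ler_wpM2l; first exact: ltW.
  by rewrite lef_pV2 ?posrE//; lra.
- move=> x x1; rewrite -[- s]mulN1r powRrM powR_inv1 ?enorm_ge0//.
  rewrite -powRM ?(ltW C0) ?invr_ge0 ?enorm_ge0//.
  apply: ge0_ler_powR; rewrite ?nnegrE ?u0//; first lra.
    by rewrite mulr_ge0 ?invr_ge0 ?enorm_ge0// ltW.
  apply: le_trans (uC x) _; apply: ler_wpM2l; first exact: ltW.
  by rewrite lef_pV2 ?posrE//; lra.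
Qed.

(** The cubes with corner [(2 ^ k, 2 ^ k, 2 ^ k)] and side [2 ^ k] are
    disjoint, and each contributes at least a constant to the integral of
    [|x| ^ - s]. *)
Lemma inv_pow_not_integrable a (c s : R) u :
  0 < a -> 0 < c -> 0 < s -> s <= 3 ->
  borel3 u -> (forall x, c / (a + enorm x) <= u x) ->
  ~ (int3 (fun x => (u x `^ s)%R) < +oo)%E.
Proof.
move=> a0 c0 s0 s3 mu uc fin.
have cx x : 0 < c / (a + enorm x).
  by rewrite divr_gt0//; have := enorm_ge0 x; lra.
have u0 x : 0 < u x := lt_le_trans (cx x) (uc x).
have [J [J0 JE]] := int3_fin (fun x => powR_ge0 _ _) fin.
pose cor k : space3 R := (2 ^+ k, 2 ^+ k, 2 ^+ k).
pose m := (c / (a + 4)) `^ s.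
have m0 : 0 < m by rewrite powR_gt0// divr_gt0//; lra.
pose g k z : R := if cubep (cor k) (2 ^+ k) z then u z `^ s else 0.
have bg k : borel3 (g k).
  by apply: borel3_if; [exact: borelp_cube|bor|bor].
have g0 k z : 0 <= g k z by rewrite /g; case: ifP => _; rewrite ?powR_ge0.
have two0 k : 0 < 2 ^+ k :> R by rewrite exprn_gt0.
have gm k : (m%:E <= int3 (g k))%E.
  pose l := m * (2 ^+ k) `^ (- s).
  have l0 : 0 <= l by rewrite mulr_ge0 ?powR_ge0// ltW.
  apply: (@le_trans _ _ (l%:E * ((2 ^+ k) ^+ 3)%:E)%E).
    rewrite -EFinM lee_fin /l -mulrA (powR_cube _ (two0 k)) -[leLHS]mulr1.
    apply: ler_wpM2l; first exact: ltW.
    have h1 : 1 <= 2 ^+ k :> R by apply: exprn_ege1; lra.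
    by rewrite -[leLHS](powRr0 (2 ^+ k)); apply: ler_powR => //; lra.
  rewrite -(int3_cube (cor k) (ltW (two0 k))) -int3Z//; last 2 first.
  - by apply: borel3_if; [exact: borelp_cube|bor|bor].
  - by move=> z; case: ifP.
  apply: int3_le => z; first by rewrite mulr_ge0//; case: ifP.
  rewrite /g; case: ifP => [|_]; last by rewrite mulr0.
  move=> /andP[/= z1 /and5P[z2 z3 z4 z5 z6]].
  have tk := two0 k.
  have zn : enorm z <= 4 * 2 ^+ k.
    apply: enorm_le; first by lra.
    have e1 : z.1.1 ^+ 2 <= 4 * (2 ^+ k) ^+ 2 by nra.
    have e2 : z.1.2 ^+ 2 <= 4 * (2 ^+ k) ^+ 2 by nra.
    have e3 : z.2 ^+ 2 <= 4 * (2 ^+ k) ^+ 2 by nra.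
    by rewrite exprMn; nra.
  rewrite mulr1 /l /m -mulN1r powRrM powR_inv1 ?(ltW tk)// -powRM; last 2 first.
  - by rewrite divr_ge0//; lra.
  - by rewrite invr_ge0 ltW.
  apply: ge0_ler_powR; rewrite ?nnegrE ?(ltW (u0 _)) ?(ltW s0)//.
    by rewrite mulr_ge0 ?invr_ge0 ?(ltW tk)// divr_ge0//; lra.
  apply: le_trans (uc z); rewrite -mulrA -invfM; apply: ler_wpM2l; first exact: ltW.
  have p1 : 0 < a + enorm z by have := enorm_ge0 z; lra.
  have p2 : 0 < (a + 4) * 2 ^+ k by rewrite mulr_gt0//; lra.
  rewrite lef_pV2 ?posrE//.
  have h1 : 1 <= 2 ^+ k :> R by apply: exprn_ege1; lra.
  by have := ler_wpM2l (ltW a0) h1; lra.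
have sum n : ((n%:R * m)%:E <= int3 (fun x => (u x `^ s)%R))%E.
  pose h k z : R := if z.1.1 < 2 ^+ k then u z `^ s else 0.
  have bh k : borel3 (h k) by rewrite /h; bor.
  have h0 k z : 0 <= h k z by rewrite /h; case: ifP => _; rewrite ?powR_ge0.
  apply: (@le_trans _ _ (int3 (h n))).
    elim: n => [|n IH]; first by rewrite mul0r int3_ge0.
    apply: (@le_trans _ _ (int3 (h n) + int3 (g n))%E).
      by rewrite -natr1 mulrDl mul1r EFinD leeD.
    rewrite -int3D//; apply: int3_le => z; first by rewrite addr_ge0.
    rewrite /h /g exprS; case: ltP => h1.
      rewrite [in X in _ + X]/cubep/= (leNgt (2 ^+ n) z.1.1) h1/= addr0 ifT//.
      by have := two0 n; lra.
    rewrite add0r; case: ifP => [|_].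
      move=> /andP[/= _ /and5P[z2 _ _ _ _]]; rewrite ifT//; lra.
    by case: ifP => _; rewrite ?powR_ge0.
  apply: int3_le => // z; rewrite /h; case: ifP => _ //; exact: powR_ge0.
have := sum (Num.bound (J / m)); rewrite JE lee_fin.
have := archi_boundP (divr_ge0 J0 (ltW m0)); rewrite ltr_pdivrMr//; lra.
Qed.

End LpSpaces.


(** * Moving planes *)

Section Reflection.
Context {R : realType}.
Implicit Types (l m : R) (x y z : space3 R) (f : space3 R -> R).

Definition refl l x : space3 R := (2 * l - x.1.1, x.1.2, x.2).

Lemma volpres_refl l : volpres (refl l).
Proof.
apply: volpres_ext (volpres_comp (volpres_shear1 0 0 (2 * l)) volpres_flip1).
by move=> x; rewrite /refl /=; congr (_, _, _); ring.
Qed.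

Lemma reflK l : involutive (refl l).
Proof. by move=> [[x1 x2] x3]; rewrite /refl /=; congr (_, _, _); ring. Qed.

Lemma enorm_refl l x y : enorm (refl l x - y) = enorm (x - refl l y).
Proof. by apply: eq_enorm; rewrite /refl /=; ring. Qed.

Lemma enorm_refl2 l x y : enorm (refl l x - refl l y) = enorm (x - y).
Proof. by rewrite enorm_refl reflK. Qed.

Lemma enorm_refl_lt l x y : l < x.1.1 -> l < y.1.1 ->
  enorm (x - y) < enorm (refl l x - y).
Proof.
move=> lx ly; apply: enorm_lt; rewrite ?enorm_ge0// enorm_sqr /refl /=.
have : 0 < (x.1.1 - l) * (y.1.1 - l) by rewrite mulr_gt0// subr_gt0.
nra.
Qed.

Lemma enorm_refl_refl l m x : l <= m ->
  enorm (refl m x - refl l x) = 2 * (m - l).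
Proof.
move=> lm; rewrite -[RHS](@enorm_axis R); last by lra.
by apply: eq_enorm; rewrite /refl /=; ring.
Qed.

Lemma volume3_plane l : measurable ([set z : mspace R | z.1.1 = l]) /\
  volume3 R [set z : mspace R | z.1.1 = l] = 0%E.
Proof.
have E : [set z : mspace R | z.1.1 = l] = [set l] `*` setT `*` setT.
  by apply/seteqP; split => [z /= -> //|[[z1 z2] z3] /= [[-> _] _]].
have m1 : measurable ([set l] : set (measurableTypeR R)).
  exact: measurable_set1.
rewrite E; split; first by do 2?apply: measurableX.
transitivity (area ([set l] `*` setT) * lebesgue_measure (setT : set R))%E.
  by apply: (product_measure1E area) => //; exact: measurableX.
transitivity (lebesgue_measure ([set l] : set R) * lebesgue_measure (setT : set R)
    * lebesgue_measure (setT : set R))%E.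
  by congr (_ * _)%E; exact: product_measure1E.
by rewrite lebesgue_measure_set1 !mul0e.
Qed.

(** The plane is a null set, and the reflection exchanges the two
    half-spaces. *)
Lemma int3_reflect f l : borel3 f -> (forall z, 0 <= f z) ->
  int3 f = int3 (fun z => if l < z.1.1 then f z + f (refl l z) else 0).
Proof.
move=> mf f0; have [mp p0] := volume3_plane l.
have [mr pr] := volpres_refl l.
pose f1 z := if l < z.1.1 then f z else 0.
pose f2 z := if z.1.1 < l then f z else 0.
have m1 : borel3 f1 by rewrite /f1; bor.
have m2 : borel3 f2 by rewrite /f2; bor.
have f10 z : 0 <= f1 z by rewrite /f1; case: ifP.
have f20 z : 0 <= f2 z by rewrite /f2; case: ifP.
transitivity (int3 (fun z => f1 z + f2 z)).
  apply: (int3_null mp p0) => // z; first by rewrite addr_ge0.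
  rewrite /f1 /f2 => Nz; case: (ltgtP l z.1.1) => h; rewrite ?addr0 ?add0r//.
  by case: Nz.
have m2' : borel3 (fun z => f2 (refl l z)) by exact: borel3_comp.
rewrite int3D// -(pr f2)// -int3D//; apply: eq_int3 => z.
rewrite /f1 /f2 /refl /=.
have -> : (2 * l - z.1.1 < l) = (l < z.1.1) by apply/idP/idP => h; lra.
by case: ifP => _; rewrite ?addr0.
Qed.

Lemma int3_eq0 f : borel3 f -> (forall z, 0 <= f z) -> int3 f = 0%E ->
  exists N : set (mspace R), [/\ measurable N, volume3 R N = 0%E
    & forall z, ~ N z -> f z = 0].
Proof.
move=> mf f0 i0.
have mfe : measurable_fun [set: mspace R] (fun z => (f z)%:E).
  by apply/measurable_EFinP.
have : (\int[volume3 R]_z `|(f z)%:E|)%E = 0%E.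
  rewrite -[RHS]i0 int3E; apply: eq_integral => z _.
  by rewrite gee0_abs// lee_fin.
move=> /(ae_eq_integral_abs (volume3 R) measurableT mfe)[N [mN N0 sub]].
exists N; split => // z Nz; apply: contrapT => fz; apply: Nz; apply: sub.
by move=> /(_ I) /= [].
Qed.

End Reflection.

Section PowerIneq.
Context {R : realType}.

Lemma bernoulli_sub (r : R) n : 0 <= r <= 1 -> 1 - r ^+ n <= n%:R * (1 - r).
Proof.
move=> /andP[r0 r1]; elim: n => [|n IH]; first by rewrite expr0; lra.
have h := ler_wpM2l r0 IH.
have h2 : r * (n%:R * (1 - r)) <= n%:R * (1 - r).
  by rewrite -[leRHS]mul1r; apply: ler_wpM2r => //; rewrite mulr_ge0//; lra.
by rewrite exprS -natr1; lra.
Qed.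

(** With [r = s / t] this is [1 - r ^ q <= 1 - r ^ n <= n * (1 - r)]. *)
Lemma powR_sub_le (s t q : R) n : 0 < s -> s <= t -> q <= n%:R ->
  t `^ q - s `^ q <= n%:R * t `^ (q - 1) * (t - s).
Proof.
move=> s0 st qn; have t0 : 0 < t by lra.
pose r := s / t.
have r0 : 0 < r by rewrite divr_gt0.
have r1 : r <= 1 by rewrite ler_pdivrMr// mul1r.
have sE : s = r * t by rewrite /r mulfVK// gt_eqF.
have h1 : r ^+ n <= r `^ q.
  by rewrite -powR_mulrn ?(ltW r0)//; apply: ger_powR => //; rewrite r0.
have h2 := @bernoulli_sub r n; rewrite (ltW r0) r1 in h2.
have {}h2 := h2 isT.
have -> : t - s = t * (1 - r) by rewrite sE; ring.
have tq : t `^ (q - 1) * t = t `^ q.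
  rewrite -{2}(powRr1 (ltW t0)) -powRD; last by rewrite (gt_eqF t0) implybT.
  by rewrite subrK.
have -> : n%:R * t `^ (q - 1) * (t * (1 - r)) = t `^ q * (n%:R * (1 - r)).
  by rewrite -tq; ring.
rewrite sE powRM ?(ltW r0) ?(ltW t0)//.
have := ler_wpM2l (powR_ge0 t q) h2; have := ler_wpM2l (powR_ge0 t q) h1.
lra.
Qed.

End PowerIneq.

Section MovingPlane.
Context {R : realType}.
Implicit Types (a q l : R) (u : space3 R -> R) (x y : space3 R).

(** What the method of moving planes uses of a solution; all of it is invariant
    under isometries. *)
Definition decaying a q u :=
  [/\ solves a q u, 3 < q, (int3 (fun x => (u x `^ q)%R) < +oo)%E,
    exists M, forall x, u x <= M
  & forall e, 0 < e -> exists rho, forall x, rho <= enorm x -> u x <= e].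

Definition dominated l u := forall x, l < x.1.1 -> u x <= u (refl l x).

(** Folding the equation along the plane: the kernel at the reflected source is
    the kernel at the reflected point. *)
Lemma decaying_unfolded a q u l : 0 < a -> decaying a q u -> forall x,
  [/\ (u x)%:E = int3 (fun z => if l < z.1.1
        then kern a (enorm (x - z)) * u z `^ q
           + kern a (enorm (refl l x - z)) * u (refl l z) `^ q else 0)
    & (u (refl l x))%:E = int3 (fun z => if l < z.1.1
        then kern a (enorm (refl l x - z)) * u z `^ q
           + kern a (enorm (x - z)) * u (refl l z) `^ q else 0)].
Proof.
move=> a0 [[mu u0 uE] q3 _ _ _] x; split.
  rewrite uE (int3_reflect l (solves_borel_integrand q x a0 mu)
    (solves_integrand_ge0 q u a0 x)).
  by apply: eq_int3 => z; rewrite -enorm_refl.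
rewrite uE (int3_reflect l (solves_borel_integrand q (refl l x) a0 mu)
  (solves_integrand_ge0 q u a0 (refl l x))).
by apply: eq_int3 => z; rewrite enorm_refl2.
Qed.

Lemma int3_kern_pow a q : 0 < a -> 3 < q -> exists I, 0 <= I /\
  forall x, int3 (fun z => kern a (enorm (x - z)) `^ q) = I%:E.
Proof.
move=> a0 q3.
have bk : borel3 (fun z : space3 R => kern a (enorm z)).
  by apply: borel3_kern => //; bor.
have k0 (z : space3 R) : 0 <= kern a (enorm z) `^ q by exact: powR_ge0.
have fin : (int3 (fun z : space3 R => (kern a (enorm z) `^ q)%R) < +oo)%E.
  apply: (inv_pow_integrable_lt a0 (ltr0n R 2) q3 bk).
    by move=> z; exact/ltW/kern_gt0.
  by move=> z; apply: kern_le2 => //; exact: enorm_ge0.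
have [I [I0 IE]] := int3_fin k0 fin.
exists I; split; [exact: I0|move=> x; rewrite -IE].
have [mT pT] := volpres_subl x.
exact: (pT (fun z => kern a (enorm z) `^ q) (borel3_powR q bk) k0).
Qed.

(** If the bad set carries little mass then it is empty. On it the kernel times
    [u ^ (q - 1)] is at most [d ^ (q - 1) * kern ^ q + u ^ q / d], according to
    whether [u <= d * kern] or not; the first term has a fixed integral, which
    [d] makes small, and [eta] makes the second one small. The largest excess
    [S] of [u] over its reflection then satisfies [S <= S / 2]. *)
Lemma dominated_small a q u : 0 < a -> decaying a q u ->
  exists eta, 0 < eta /\ forall l,
    (int3 (fun z => (if (l < z.1.1) && (u (refl l z) < u z)
       then u z `^ q else 0)%R) <= eta%:E)%E ->
    dominated l u.
Proof.
move=> a0 du; have [su q3 qfin [M uM] _] := du; have [mu u0 uE] := su.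
have [I [I0 IE]] := int3_kern_pow a0 q3.
pose n := Num.bound q.
have qn : q <= n%:R by apply/ltW/archi_boundP; lra.
have n0 : 0 < n%:R :> R by lra.
have q1 : 0 < q - 1 by lra.
pose c := (4 * n%:R * (I + 1))^-1.
have c0 : 0 < c by rewrite invr_gt0 mulr_gt0 ?mulr_gt0//; lra.
pose d := c `^ (q - 1)^-1.
have d0 : 0 < d by rewrite powR_gt0.
have dc : d `^ (q - 1) = c.
  by rewrite -powRrM mulVf ?powRr1// ?(ltW c0)// gt_eqF.
exists (d / (4 * n%:R)); split; first by rewrite divr_gt0// mulr_gt0.
move=> l small.
have [mr pr] := volpres_refl (R := R) l.
pose v z := u (refl l z).
have mv : borel3 v by exact: borel3_comp.
pose bad z := (l < z.1.1) && (v z < u z).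
have bbad : borelp bad by rewrite /bad; bor.
pose E := [set s | s = 0 \/ exists x, l < x.1.1 /\ s = u x - v x].
have supE : has_sup E.
  split; first by exists 0; left.
  exists M => _ [->|[x [_ ->]]].
    by have := u0 0; have := uM 0; lra.
  by have := u0 (refl l x); have := uM x; rewrite /v; lra.
set S := sup E.
have S0 : 0 <= S by apply: ub_le_sup; [case: supE|left].
have uS x : l < x.1.1 -> u x - v x <= S.
  by move=> lx; apply: ub_le_sup; [case: supE|right; exists x].
suff half x : l < x.1.1 -> u x - v x <= S / 2.
  have S2 : S <= S / 2.
    apply: ge_sup; first by case: supE.
    by move=> _ [->|[x [lx ->]]]; [lra|exact: half].
  by move=> x lx; have := half x lx; rewrite /v; lra.
move=> lx.
have kg0 y z : 0 <= kern a (enorm (y - z)) by exact/ltW/kern_gt0.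
pose B z := if l < z.1.1 then kern a (enorm (refl l x - z)) * u z `^ q
           + kern a (enorm (x - z)) * u (refl l z) `^ q else 0.
have B0 z : 0 <= B z.
  by rewrite /B; case: ifP => // _; rewrite addr_ge0// mulr_ge0 ?powR_ge0.
have bB : borel3 B.
  have b1 := borel3_kerns x a0; have b2 := borel3_kerns (refl l x) a0.
  by rewrite /B; apply: borel3_if; [bor| |bor]; apply: borel3D;
    apply: borel3M => //; bor.
pose h1 z := n%:R * S * c * kern a (enorm (x - z)) `^ q.
pose h2 z := n%:R * S / d * (if bad z then u z `^ q else 0).
have nS : 0 <= n%:R * S by rewrite mulr_ge0// ltW.
have c1 : 0 <= n%:R * S * c by rewrite mulr_ge0// ltW.
have c2 : 0 <= n%:R * S / d by rewrite divr_ge0// ltW.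
have bk : borel3 (fun z => kern a (enorm (x - z)) `^ q).
  by apply: borel3_powR; exact: borel3_kerns.
have bu : borel3 (fun z => if bad z then u z `^ q else 0).
  by apply: borel3_if => //; bor.
have i0 z : 0 <= (if bad z then u z `^ q else 0).
  by case: ifP => _; rewrite ?powR_ge0.
have h10 z : 0 <= h1 z by rewrite /h1 mulr_ge0 ?powR_ge0.
have h20 z : 0 <= h2 z by rewrite /h2 mulr_ge0.
have bh1 : borel3 h1 by apply: borel3M => //; bor.
have bh2 : borel3 h2 by apply: borel3M => //; bor.
have [ux vx] := decaying_unfolded l a0 du x.
have : ((u x)%:E <= (v x)%:E + ((n%:R * S * c * I)%:E
    + (n%:R * S / d * (d / (4 * n%:R)))%:E))%E.
  apply: (@le_trans _ _ (int3 B + (int3 h1 + int3 h2))%E); last first.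
    rewrite /v vx; apply: leeD => //; apply: leeD.
      by rewrite /h1 int3Z// ?IE -?EFinM// => z; exact: powR_ge0.
    rewrite /h2 int3Z// [leRHS]EFinM; apply: lee_wpmul2l => //.
  rewrite -(int3D bh1 bh2 h10 h20).
  rewrite -(int3D bB (borel3D bh1 bh2) B0 (fun z => addr_ge0 (h10 z) (h20 z))).
  rewrite ux; apply: int3_le => z.
    by case: ifP => // _; rewrite addr_ge0// mulr_ge0 ?powR_ge0.
  rewrite /B; case: ifP => lz; last by rewrite add0r addr_ge0.
  have kk : kern a (enorm (refl l x - z)) <= kern a (enorm (x - z)).
    apply/ltW/kern_decr => //; first exact: enorm_ge0.
    exact: enorm_refl_lt.
  have := kg0 x z; have := kg0 (refl l x) z.
  move: kk; set A := kern a (enorm (x - z)); set A' := kern a _ => kk A'0 A0.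
  have [vu|uv] := ltP (v z) (u z); last first.
    have uq : u z `^ q <= u (refl l z) `^ q.
      by apply: ge0_ler_powR; rewrite ?nnegrE ?(ltW (u0 _))//; lra.
    have := h10 z; have := h20 z.
    by move: kk A'0 A0 uq; clear; nra.
  have key : A * (u z `^ q - v z `^ q) <= h1 z + h2 z.
    have bz : bad z by rewrite /bad lz.
    have uz := u0 z; have vz : 0 < v z := u0 _.
    have sub := powR_sub_le vz (ltW vu) qn.
    have uvS : u z - v z <= S by exact: uS.
    set U := u z `^ (q - 1) in sub.
    have U0 : 0 <= U by exact: powR_ge0.
    have s1 : u z `^ q - v z `^ q <= n%:R * U * S.
      by apply: le_trans sub _; apply: ler_wpM2l => //; rewrite mulr_ge0// ltW.
    have UqE : u z * U = u z `^ q by rewrite mulr_powRB1// ?ltW//; lra.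
    have AU : A * U <= c * A `^ q + u z `^ q / d.
      have Apos : 0 < A by exact: kern_gt0.
      have AqE : A * A `^ (q - 1) = A `^ q by rewrite mulr_powRB1//; lra.
      have q1' : 0 <= c * A `^ q by rewrite mulr_ge0 ?powR_ge0// ltW.
      have q2' : 0 <= u z `^ q / d by rewrite divr_ge0 ?powR_ge0// ltW.
      have [h|h] := leP (u z) (d * A).
        have : U <= c * A `^ (q - 1).
          rewrite -dc -powRM ?(ltW d0)//.
          apply: ge0_ler_powR; rewrite ?nnegrE ?(ltW uz)// ?mulr_ge0 ?(ltW d0)//.
          exact: ltW.
        by move=> /(ler_wpM2l A0); rewrite mulrCA AqE; lra.
      have : A <= u z / d by rewrite ler_pdivlMr// mulrC ltW.
      by move=> /(ler_wpM2r U0); rewrite mulrAC UqE; lra.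
    apply: le_trans (ler_wpM2l A0 s1) _.
    have := ler_wpM2l nS AU; rewrite /h1 /h2 bz -/A.
    by move: (A `^ q) (u z `^ q) => X Y; lra.
  have vE : v z = u (refl l z) by [].
  have vq : v z `^ q <= u z `^ q.
    by apply: ge0_ler_powR; rewrite ?nnegrE ?(ltW (u0 _))//; lra.
  rewrite -vE; move: kk A'0 A0 key vq.
  move: (h1 z + h2 z) (u z `^ q) (v z `^ q) => H X Y; clear; nra.
rewrite -!EFinD lee_fin.
have e1 : n%:R * S / d * (d / (4 * n%:R)) = S / 4.
  by field; rewrite !gt_eqF.
have e2 : n%:R * S * c * I <= S / 4.
  have : c * (4 * n%:R * (I + 1)) = 1.
    by rewrite /c mulVf// gt_eqF// !mulr_gt0//; lra.
  move=> cE; have : 4 * (n%:R * c * I) <= 1.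
    by rewrite -[leRHS]cE; have := mulr_gt0 n0 c0; lra.
  by move=> /(ler_wpM2l S0); lra.
by rewrite e1; lra.
Qed.

End MovingPlane.


Section MovingPlaneLimit.
Context {R : realType}.
Implicit Types (a q l m : R) (u : space3 R -> R) (x y : space3 R).

(** By [decaying_unfolded] the difference of the two values is the integral
    over the half-space of a nonnegative function. If it vanishes at one point
    then [u ^ q] is symmetric almost everywhere, and the equation makes [u]
    symmetric everywhere. *)
Lemma dominated_strict a q u l : 0 < a -> decaying a q u -> dominated l u ->
  (forall x, u x = u (refl l x)) \/
  (forall x, l < x.1.1 -> u x < u (refl l x)).
Proof.
move=> a0 du dom; have [su q3 qfin _ _] := du; have [mu u0 uE] := su.
have [mr pr] := volpres_refl (R := R) l.
pose v z := u (refl l z).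
have mv : borel3 v by exact: borel3_comp.
have kg0 y z : 0 <= kern a (enorm (y - z)) by exact/ltW/kern_gt0.
have vq z : l < z.1.1 -> u z `^ q <= v z `^ q.
  move=> lz; apply: ge0_ler_powR; rewrite ?nnegrE ?(ltW (u0 _))//; first lra.
  exact: dom.
have [st|/existsNP[x]] := pselect (forall x, l < x.1.1 -> u x < u (refl l x)).
  by right.
move=> /not_implyP[lx /negP]; rewrite -leNgt => xv; left.
have xE : u x = u (refl l x) by apply/eqP; rewrite eq_le xv dom.
pose D z := if l < z.1.1 then
  (kern a (enorm (x - z)) - kern a (enorm (refl l x - z)))
   * (v z `^ q - u z `^ q) else 0.
have kk z : l < z.1.1 ->
    kern a (enorm (refl l x - z)) < kern a (enorm (x - z)).
  move=> lz; apply: kern_decr => //; first exact: enorm_ge0.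
  exact: enorm_refl_lt.
have D0 z : 0 <= D z.
  rewrite /D; case: ifP => // lz.
  by rewrite mulr_ge0// subr_ge0; [exact/ltW/kk|exact: vq].
have b1 := borel3_kerns x a0; have b2 := borel3_kerns (refl l x) a0.
have bD : borel3 D.
  rewrite /D; apply: borel3_if; [by bor| |by bor].
  by apply: borel3M; apply: borel3B => //; bor.
have [ux vx] := decaying_unfolded l a0 du x.
pose B z := if l < z.1.1 then kern a (enorm (x - z)) * u z `^ q
  + kern a (enorm (refl l x - z)) * u (refl l z) `^ q else 0.
have B0 z : 0 <= B z.
  by rewrite /B; case: ifP => // _; rewrite addr_ge0// mulr_ge0 ?powR_ge0.
have bB : borel3 B.
  by rewrite /B; apply: borel3_if; [bor| |bor]; apply: borel3D;
    apply: borel3M => //; bor.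
have sum : (int3 B + int3 D = (u x)%:E)%E.
  rewrite xE vx -(int3D bB bD B0 D0).
  apply: eq_int3 => z; rewrite /B /D; case: ifP => _; last by rewrite addr0.
  by rewrite /v; ring.
have intD : int3 D = 0%E.
  have Bx : int3 B = (u x)%:E := esym ux.
  have Dx : (int3 D <= (u x)%:E)%E.
    by rewrite -sum leeDr// int3_ge0.
  have [J [J0 JE]] := int3_fin D0 (le_lt_trans Dx (ltry _)).
  by move: sum; rewrite Bx JE -EFinD => -[h]; congr EFin; lra.
have [N [mN N0 DN]] := int3_eq0 bD D0 intD.
have uv z : ~ N z -> l < z.1.1 -> u z `^ q = v z `^ q.
  move=> /DN; rewrite /D => h lz; move: h; rewrite lz => /eqP.
  rewrite mulf_eq0 !subr_eq0 => /orP[/eqP h|/eqP //].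
  by have := kk z lz; rewrite h ltxx.
move=> y; have [uy vy] := decaying_unfolded l a0 du y.
have p0 y' z : 0 <= (if l < z.1.1 then kern a (enorm (y' - z)) * u z `^ q
  + kern a (enorm (refl l y' - z)) * u (refl l z) `^ q else 0).
  by case: ifP => // _; rewrite addr_ge0// mulr_ge0 ?powR_ge0.
have : (u y)%:E = (u (refl l y))%:E.
  rewrite uy vy; apply: (int3_null mN N0) => z.
  - exact: p0.
  - by case: ifP => // _; rewrite addr_ge0// mulr_ge0 ?powR_ge0.
  - move=> Nz; case: ifP => // lz; rewrite (uv z Nz lz) /v; ring.
by move=> [].
Qed.

(** Two parallel symmetry planes make [u] periodic, but [u] vanishes at
    infinity. *)
Lemma one_symmetry_plane a q u l m : decaying a q u ->
  (forall x, u x = u (refl l x)) -> (forall x, u x = u (refl m x)) ->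
  ~ l < m.
Proof.
move=> [[_ u0 _] _ _ _ van] symm_l symm_m lm.
pose x n : space3 R := (n%:R * (2 * (m - l)), 0, 0).
have ux n : u (x n) = u (x 0%N).
  elim: n => // n <-; rewrite [RHS]symm_l [RHS]symm_m; congr u.
  by rewrite /refl /x /=; congr (_, _, _); rewrite -natr1; ring.
have u2 : 0 < u (x 0%N) / 2 by rewrite divr_gt0.
have [rho H] := van _ u2.
have d0 : 0 < 2 * (m - l) by lra.
pose n := Num.bound (rho / (2 * (m - l))).
have := H (x n); rewrite ux enorm_axis; last by rewrite mulr_ge0// ltW.
move=> /(_ _)/wrap[].
  have [r0|r0] := leP 0 rho; last by apply: le_trans (ltW r0) _; rewrite mulr_ge0// ltW.
  by rewrite -ler_pdivrMr//; apply/ltW/archi_boundP; rewrite divr_ge0// ltW.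
by have := u0 (x 0%N); lra.
Qed.

Lemma le_expR_limit (x y d : R) : 0 < y -> 0 < d ->
  (forall t, 0 < t -> t < d -> x <= expR t * y) -> x <= y.
Proof.
move=> y0 d0 H; rewrite leNgt; apply/negP => yx.
have x0 : 0 < x by lra.
have g0 : 0 < 1 - y / x by rewrite subr_gt0 ltr_pdivrMr// mul1r.
pose t := Num.min (d / 2) ((1 - y / x) / 2).
have t0 : 0 < t by rewrite lt_min !divr_gt0.
have td : t < d by apply: (@le_lt_trans _ _ (d / 2)); rewrite ?ge_min ?lexx//; lra.
have tg : t <= (1 - y / x) / 2 by rewrite ge_min lexx orbT.
have := H t t0 td.
have e1 : 1 - t <= expR (- t) := expR_ge1Dx _.
have e2 : expR t * expR (- t) = 1 by rewrite -expRD subrr expR0.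
have e3 : y = (y / x) * x by rewrite mulfVK// gt_eqF.
have et := expR_gt0 t; move=> h.
have h2 : y < (1 - t) * x by rewrite e3 ltr_pM2r//; lra.
have h3 : (1 - t) * x <= expR (- t) * x by apply: ler_wpM2r => //; exact: ltW.
have h4 : expR t * y < expR t * (expR (- t) * x) by rewrite ltr_pM2l//; lra.
by move: h4; rewrite mulrA e2; lra.
Qed.

(** [l] is the last position before the domination fails. The Harnack
    inequality extends the domination to [l]. Were it strict there, bad sets
    for positions slightly below [l] would shrink to the plane, their mass
    would tend to [0], and [dominated_small] would push the plane beyond
    [l]. *)
Lemma exists_symmetry_plane a q u : 0 < a -> decaying a q u ->
  exists l, (forall x, u x = u (refl l x)) /\
    forall m, l < m -> forall x, m < x.1.1 -> u x < u (refl m x).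
Proof.
move=> a0 du; have [su q3 qfin [M uM] van] := du; have [mu u0 uE] := su.
have q0 : 0 < q by lra.
have [eta [eta0 small]] := dominated_small a0 du.
have uq0 z : 0 <= u z `^ q by exact: powR_ge0.
have buq : borel3 (fun z => u z `^ q) by bor.
have brefl m : borel3 (fun z => u (refl m z)).
  by have [mr _] := volpres_refl (R := R) m; exact: borel3_comp.
pose L := [set l | forall m, l <= m -> dominated m u].
have L1 : exists l, L l.
  have [rho [rho0 tail]] := int3_tail buq uq0 qfin eta0.
  exists rho => m rm; apply: small; apply: le_trans tail.
  apply: int3_le => z; first by case: ifP.
  case: ifP => [/andP[mz _]|_]; last by case: ifP.
  rewrite ifT//; have [h _ _] := enorm_coord z.
  by have := ler_norm z.1.1; lra.
have Llb : has_lbound L.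
  have u2 : 0 < u 0 / 2 by rewrite divr_gt0.
  have [rho H] := van _ u2.
  exists (- (`|rho| + 1)) => l Ll; rewrite leNgt; apply/negP => ll.
  pose m := - (`|rho| + 1).
  have m0 : m < 0 by rewrite /m; have := normr_ge0 rho; lra.
  have := Ll m (ltW ll) 0 m0.
  have : u (refl m 0) <= u 0 / 2.
    apply: H; rewrite (_ : refl m 0 = - (- (2 * m), 0, 0)); last first.
      by rewrite /refl /=; congr (_, _, _); rewrite /=; ring.
    rewrite enormN enorm_axis; last by lra.
    by rewrite /m; have := ler_norm rho; have := normr_ge0 rho; lra.
  by have := u0 0; lra.
have Linf : has_inf L by split.
set l := inf L.
have dom_gt m : l < m -> dominated m u.
  move=> lm; have [s Ls sm] : exists2 s, L s & s < l + (m - l).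
    by apply: inf_adherent => //; rewrite subr_gt0.
  by apply: Ls; lra.
have dom_l : dominated l u.
  move=> x lx; apply: (@le_expR_limit _ _ (2 * (x.1.1 - l) / a)) => //.
    by rewrite divr_gt0//; lra.
  move=> t t0 tx; pose m := l + t * a / 2.
  have ta0 : 0 < t * a by rewrite mulr_gt0.
  have lm : l < m by rewrite /m; lra.
  have mx : m < x.1.1 by move: tx; rewrite ltr_pdivlMr// /m; lra.
  apply: le_trans (dom_gt m lm x mx) _.
  have := solution_harnack a0 su (refl m x) (refl l x).
  rewrite enorm_refl_refl ?(ltW lm)//.
  have -> // : 2 * (m - l) / a = t by rewrite /m; field; rewrite gt_eqF.
have symm : forall x, u x = u (refl l x).
  have [//|strict] := dominated_strict a0 du dom_l; exfalso.
  pose e (n : nat) : R := n.+1%:R^-1.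
  have e0 n : 0 < e n by rewrite invr_gt0.
  have /choice[mm mmP] : forall n, exists m, l - e n <= m /\ ~ dominated m u.
    move=> n; apply: contrapT => /forallNP h.
    have : L (l - e n).
      by move=> m lm; apply: contrapT => nd; apply: (h m).
    move=> /(ge_inf (proj2 Linf)); rewrite -/l; have := e0 n; lra.
  have mml n : mm n < l.
    have [_ nd] := mmP n; rewrite ltNge le_eqVlt; apply/negP => /orP[/eqP h|h].
      by apply: nd; rewrite -h.
    by apply: nd; exact: dom_gt.
  pose f n z := if (mm n < z.1.1) && (u (refl (mm n) z) < u z)
    then u z `^ q else 0.
  have [mp p0] := volume3_plane l.
  have mf n : borel3 (f n).
    apply: borel3_if; [|by bor|by bor].
    by apply: borelp_and; [by bor|apply: borelp_lt].
  have [n Hn] : exists n, (int3 (f n) <= eta%:E)%E.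
    apply: (int3_vanishing mp p0 mf buq _ qfin) => //.
      by move=> n z; rewrite /f; case: ifP => _; rewrite ?lexx uq0.
    move=> z /= zl.
    have bound_e (d : R) : 0 < d -> exists n0, forall n, (n0 <= n)%N -> e n < d.
      move=> d0; exists (Num.bound d^-1) => n nn.
      rewrite /e -[ltRHS]invrK ltf_pV2 ?posrE ?invr_gt0//.
      apply: lt_le_trans (archi_boundP _) _; first by rewrite invr_ge0 ltW.
      by rewrite ler_nat; exact: leqW.
    have [zl'|lz|zl'] := ltgtP z.1.1 l; last by case: zl.
      have [|n0 H0] := bound_e (l - z.1.1); first by lra.
      exists n0 => n /H0 en; rewrite /f ifF//; apply/negbTE.
      by rewrite negb_and -leNgt; have [h _] := mmP n; apply/orP; left; lra.
    pose g := u (refl l z) / u z.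
    have g1 : 1 < g by rewrite ltr_pdivlMr// mul1r; exact: strict.
    have g0 : 0 < g - 1 by lra.
    (* chosen so that [expR (- t) >= 1 - t > g^-1] for the Harnack exponent [t] *)
    pose d := a * (1 - g^-1) / 2.
    have gi : g^-1 < 1 by rewrite invf_lt1//; lra.
    have d0 : 0 < d by rewrite divr_gt0// mulr_gt0//; lra.
    have [n0 H0] := bound_e d d0.
    exists n0 => n /H0 en; rewrite /f ifF//; apply/negbTE.
    rewrite negb_and; apply/orP; right; rewrite -leNgt.
    have [h _] := mmP n; have h' := mml n.
    have := solution_harnack a0 su (refl l z) (refl (mm n) z).
    rewrite enorm_refl_refl ?(ltW h')//.
    set t := 2 * (l - mm n) / a => har.
    have tg : t < 1 - g^-1.
      by rewrite /t ltr_pdivrMr//; move: en; rewrite /d; lra.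
    have uz := u0 z; have um := u0 (refl (mm n) z).
    have e1 : 1 - t <= expR (- t) := expR_ge1Dx _.
    have e2 : expR (- t) * expR t = 1 by rewrite -expRD addNr expR0.
    have gE : u (refl l z) = g * u z by rewrite /g mulfVK// gt_eqF.
    have et := expR_gt0 (- t).
    have := ler_wpM2l (ltW et) har; rewrite mulrA e2 mul1r gE => hh.
    apply: le_trans hh.
    have e3 : g^-1 <= expR (- t) by lra.
    have gu : 0 <= g * u z by rewrite mulr_ge0//; lra.
    have := ler_wpM2r gu e3; rewrite mulrA mulVf ?mul1r// gt_eqF//; lra.
  by have [_ nd] := mmP n; apply: nd; exact: small Hn.
exists l; split => // m lm.
have [sm|//] := dominated_strict a0 du (dom_gt m lm).
by case: (one_symmetry_plane du symm sm).
Qed.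

End MovingPlaneLimit.


(** * Radial symmetry *)

Section Rotations.
Context {R : realType}.
Implicit Types (x y z : space3 R).

Lemma polar_coordinates y : exists c s c' s' : R,
  [/\ c ^+ 2 + s ^+ 2 = 1, c' ^+ 2 + s' ^+ 2 = 1
    & y = (enorm y * (c * c'), enorm y * (s * c'), enorm y * s')].
Proof.
case: y => [[y1 y2] y3]; set n := enorm _.
have nE : n ^+ 2 = y1 ^+ 2 + y2 ^+ 2 + y3 ^+ 2 := enorm_sqr _.
have n0 : 0 <= n := enorm_ge0 _.
pose r := enorm (y1, y2, 0 : R).
have rE : r ^+ 2 = y1 ^+ 2 + y2 ^+ 2.
  by rewrite /r enorm_sqr /= expr0n /= addr0.
have [c [s [cs y1E y2E]]] : exists c s : R,
    [/\ c ^+ 2 + s ^+ 2 = 1, y1 = r * c & y2 = r * s].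
  have [r0|r0] := eqVneq r 0.
    have h1 : y1 = 0 by apply/eqP; rewrite -sqrf_eq0; apply/eqP; rewrite r0 in rE; nra.
    have h2 : y2 = 0 by apply/eqP; rewrite -sqrf_eq0; apply/eqP; rewrite r0 in rE; nra.
    by exists 1, 0; rewrite h1 h2 r0; split; ring.
  exists (y1 / r), (y2 / r); split; [|by field|by field].
  by rewrite !expr_div_n -mulrDl -rE divff// sqrf_eq0.
have [c' [s' [cs' rE' y3E]]] : exists c' s' : R,
    [/\ c' ^+ 2 + s' ^+ 2 = 1, r = n * c' & y3 = n * s'].
  have nrE : n ^+ 2 = r ^+ 2 + y3 ^+ 2 by rewrite nE rE.
  have [n00|n00] := eqVneq n 0.
    have h1 : r = 0 by apply/eqP; rewrite -sqrf_eq0; apply/eqP; rewrite n00 in nrE; nra.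
    have h2 : y3 = 0 by apply/eqP; rewrite -sqrf_eq0; apply/eqP; rewrite n00 in nrE; nra.
    by exists 1, 0; rewrite h1 h2 n00; split; ring.
  exists (r / n), (y3 / n); split; [|by field|by field].
  by rewrite !expr_div_n -mulrDl -nrE divff// sqrf_eq0.
exists c, s, c', s'; split => //.
by rewrite {1}y1E {1}y2E y3E rE'; congr (_, _, _); ring.
Qed.

Definition isometry (T : space3 R -> space3 R) :=
  forall x y, enorm (T x - T y) = enorm (x - y).

(** A rotation of the first and third coordinates followed by one of the first
    and second coordinates, with the polar angles of [y]. *)
Lemma rotation_to y : exists T S : space3 R -> space3 R,
  [/\ volpres T, isometry T, {morph T : x z / x - z}, cancel S T
    & T (enorm y, 0, 0) = y].
Proof.
have [c [s [c' [s' [cs cs' yE]]]]] := polar_coordinates y.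
pose A (c s : R) (x : space3 R) : space3 R :=
  (c * x.1.1 - s * x.1.2, s * x.1.1 + c * x.1.2, x.2).
pose B (c s : R) (x : space3 R) : space3 R :=
  (c * x.1.1 - s * x.2, x.1.2, s * x.1.1 + c * x.2).
have AK x : A c s (A c (- s) x) = x.
  case: x => [[x1 x2] x3]; rewrite /A /=; congr (_, _, _).
    by transitivity ((c ^+ 2 + s ^+ 2) * x1); [ring|rewrite cs mul1r].
  by transitivity ((c ^+ 2 + s ^+ 2) * x2); [ring|rewrite cs mul1r].
have BK x : B c' s' (B c' (- s') x) = x.
  case: x => [[x1 x2] x3]; rewrite /B /=; congr (_, _, _).
    by transitivity ((c' ^+ 2 + s' ^+ 2) * x1); [ring|rewrite cs' mul1r].
  by transitivity ((c' ^+ 2 + s' ^+ 2) * x3); [ring|rewrite cs' mul1r].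
have AB x z : A c s (x - z) = A c s x - A c s z.
  by case: x z => [[x1 x2] x3] [[z1 z2] z3]; congr (_, _, _); rewrite /=; ring.
have BB x z : B c' s' (x - z) = B c' s' x - B c' s' z.
  by case: x z => [[x1 x2] x3] [[z1 z2] z3]; congr (_, _, _); rewrite /=; ring.
have An x : enorm (A c s x) = enorm x.
  apply: eq_enorm; rewrite /A /=.
  transitivity ((c ^+ 2 + s ^+ 2) * (x.1.1 ^+ 2 + x.1.2 ^+ 2) + x.2 ^+ 2).
    by ring.
  by rewrite cs mul1r.
have Bn x : enorm (B c' s' x) = enorm x.
  apply: eq_enorm; rewrite /B /=.
  transitivity ((c' ^+ 2 + s' ^+ 2) * (x.1.1 ^+ 2 + x.2 ^+ 2) + x.1.2 ^+ 2).
    by ring.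
  by rewrite cs'; ring.
exists (fun x => A c s (B c' s' x)), (fun x => B c' (- s') (A c (- s) x)).
split.
- exact: volpres_comp (volpres_rot12 cs) (volpres_rot13 cs').
- by move=> x z; rewrite -AB -BB An Bn.
- by move=> x z; rewrite BB AB.
- by move=> x; rewrite BK AK.
- by rewrite [RHS]yE /A /B /=; congr (_, _, _); ring.
Qed.

End Rotations.

Section Radial.
Context {R : realType}.
Implicit Types (a q l m : R) (u : space3 R -> R) (x y z : space3 R).

Lemma decaying_isometry a q u T : 0 < a -> volpres T -> isometry T ->
  decaying a q u -> decaying a q (fun x => u (T x)).
Proof.
move=> a0 [mT pT] iT [su q3 qfin [M uM] van]; have [mu u0 uE] := su.
have pq x : 0 <= u x `^ q by exact: powR_ge0.
split.
- split; [exact: borel3_comp|by move=> x; exact: u0|move=> x; rewrite uE].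
  rewrite -(pT _ (solves_borel_integrand q (T x) a0 mu)
    (solves_integrand_ge0 q u a0 (T x))).
  by apply: eq_int3 => z; rewrite iT.
- exact: q3.
- by rewrite (pT (fun x => u x `^ q) (borel3_powR q mu) pq).
- by exists M.
- move=> e e0; have [rho H] := van e e0.
  exists (rho + enorm (T 0)) => x xr; apply: H.
  have := iT x 0; rewrite subr0 => xE.
  by have := enormD (T x) (- T 0); rewrite xE enormN; lra.
Qed.

Lemma isometry_swap12 : isometry (fun x : space3 R => (x.1.2, x.1.1, x.2)).
Proof. by move=> x y; apply: eq_enorm => /=; ring. Qed.

Lemma isometry_swap13 : isometry (fun x : space3 R => (x.2, x.1.2, x.1.1)).
Proof. by move=> x y; apply: eq_enorm => /=; ring. Qed.

(** The composition of the reflections in three orthogonal symmetry planes is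
    the reflection in their common point. *)
Lemma exists_center a q u : 0 < a -> decaying a q u ->
  exists x0, forall y, u (x0 - y) = u (x0 + y).
Proof.
move=> a0 du.
have [l1 [s1 _]] := exists_symmetry_plane a0 du.
have [l2 [s2 _]] := exists_symmetry_plane a0
  (decaying_isometry a0 volpres_swap12 isometry_swap12 du).
have [l3 [s3 _]] := exists_symmetry_plane a0
  (decaying_isometry a0 volpres_swap13 isometry_swap13 du).
exists (l1, l2, l3) => -[[y1 y2] y3].
rewrite s1 /refl /=.
have := s2 (l2 - y2, 2 * l1 - (l1 - y1), l3 - y3); rewrite /refl /= => ->.
have := s3 (l3 - y3, 2 * l2 - (l2 - y2), 2 * l1 - (l1 - y1)).
rewrite /refl /= => ->.
by congr u; congr (_, _, _); rewrite /=; ring.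
Qed.

(** In a frame attached to the center the first axis may have any direction.
    The reflection in the center carries a symmetry plane to a parallel one, so
    the plane passes through the center. *)
Lemma symmetric_frame a q u x0 T : 0 < a -> decaying a q u ->
  (forall y, u (x0 - y) = u (x0 + y)) ->
  volpres T -> isometry T -> {morph T : x z / x - z} ->
  (forall z, u (x0 + T z) = u (x0 + T (refl 0 z))) /\
  (forall m z, 0 < m -> m < z.1.1 -> u (x0 + T z) < u (x0 + T (refl m z))).
Proof.
move=> a0 du even vT iT TB.
have vT' : volpres (fun z => x0 + T z) := volpres_comp (volpres_addl x0) vT.
have iT' : isometry (fun z => x0 + T z).
  move=> x y; rewrite -[RHS]iT; congr enorm.
  by rewrite opprD addrACA subrr add0r.
have dv := decaying_isometry a0 vT' iT' du.
have [l [sl mono]] := exists_symmetry_plane a0 dv.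
have T0 : T 0 = 0 by rewrite -{1}(subrr (0 : space3 R)) TB subrr.
have TN z : T (- z) = - T z by rewrite -sub0r TB T0 sub0r.
have ev z : u (x0 + T (- z)) = u (x0 + T z) by rewrite TN even.
have snl z : u (x0 + T z) = u (x0 + T (refl (- l) z)).
  rewrite -ev sl -ev; congr (u (x0 + T _)).
  by case: z => [[z1 z2] z3]; congr (_, _, _); rewrite /=; ring.
have l0 : l = 0.
  have h1 := one_symmetry_plane dv sl snl.
  have h2 := one_symmetry_plane dv snl sl.
  by have [h|h|//] := ltgtP l 0; [case: h1|case: h2]; lra.
by rewrite l0 in sl mono; split => // m z m0 mz; exact: mono.
Qed.

(** Two points at equal distance from the center are exchanged by the
    reflection in the direction of their difference; for different distances
    the monotonicity along the ray through the farther point applies. *)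
Lemma decaying_radial a q u : 0 < a -> decaying a q u ->
  exists x0, radially_decreasing_about x0 u.
Proof.
move=> a0 du; have [x0 even] := exists_center a0 du.
have rad x y : enorm x = enorm y -> u (x0 + x) = u (x0 + y).
  move=> xy; have [->//|nxy] := eqVneq x y.
  have [T [S [vT iT TB SK Ty]]] := rotation_to (x - y).
  have [sym _] := symmetric_frame a0 du even vT iT TB.
  have n0 : 0 < enorm (x - y) by apply: enorm_gt0; rewrite subr_eq0.
  set n := enorm (x - y) in n0 Ty.
  rewrite -{1}(SK x) sym; congr (u (x0 + _)).
  set z := S x; have zx : T z = x := SK x.
  have T0 : T 0 = 0 by rewrite -{1}(subrr (0 : space3 R)) TB subrr.
  have z1 : z.1.1 = n / 2.
    have e1 : enorm z = enorm x by have := iT z 0; rewrite T0 zx !subr0.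
    have e2 : enorm (z - (n, 0, 0)) = enorm z.
      by rewrite -iT zx Ty subKr e1.
    have := enorm_sqr (z - (n, 0, 0)); rewrite e2 enorm_sqr /= !subr0 => h.
    have : n * (n - 2 * z.1.1) = 0 by lra.
    by move=> /eqP; rewrite mulf_eq0 gt_eqF//= => /eqP; lra.
  have -> : refl 0 z = z - (n, 0, 0).
    by rewrite /refl; case: z z1 {zx} => [[? ?] ?] /= ->;
      congr (_, _, _); rewrite /=; field.
  by rewrite TB zx Ty subKr.
exists x0; split => x y.
  by move=> /rad; rewrite ![x0 + _]addrC !subrK.
move=> xy; set x' := x - x0 in xy *; set y' := y - x0 in xy *.
have [T [S [vT iT TB SK Ty]]] := rotation_to y'.
have [_ mono] := symmetric_frame a0 du even vT iT TB.
have x'0 := enorm_ge0 x'.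
have T0 : T 0 = 0 by rewrite -{1}(subrr (0 : space3 R)) TB subrr.
pose m := (enorm x' + enorm y') / 2.
have m0 : 0 < m by rewrite /m; lra.
have my : m < enorm y' by rewrite /m; lra.
have := mono m (enorm y', 0, 0) m0 my.
have -> : refl m (enorm y', 0, 0) = (enorm x', 0, 0).
  by rewrite /refl /m /=; congr (_, _, _); field.
rewrite Ty (rad (T (enorm x', 0, 0)) x').
  by rewrite /x' /y' ![x0 + _]addrC !subrK.
by have := iT (enorm x', 0, 0) 0; rewrite T0 !subr0 enorm_axis.
Qed.

End Radial.

Theorem theorem1p5 (R : realType) (a q : R) (u : space3 R -> R)
    (ha : 0 < a) (hq : 0 < q)
    (huL : memLp3 ((3 * (q - 1) / 2)%:E) u)
    (hu : is_positive_solution a q u) :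
  [/\ (forall s : \bar R, (3%:E < s)%E -> memLp3 s u) /\
      (forall s : R, 0 < s -> s <= 3 -> ~ memLp3 s%:E u),
      exists x0 : space3 R, radially_decreasing_about x0 u
    & exists C : R, 1 < C /\
        exists M : R, forall x : space3 R, M < enorm x ->
          C^-1 * bp_kernel a x <= u x /\ u x <= C * bp_kernel a x].
Proof.
have [mL finL] := huL.
have su := positive_solution_solves ha hq mL hu; have [mu u0 uE] := su.
have normE s : (\int[volume3 R]_x (`|u x| `^ s)%:E)%E
    = int3 (fun x => u x `^ s).
  by rewrite int3E; apply: eq_integral => x _; rewrite ger0_norm// ltW.
have fin : (int3 (fun x => (u x `^ (3 * (q - 1) / 2))%R) < +oo)%E.
  by rewrite -normE.
have q1 := solution_exponent_gt1 ha hq su fin.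
have q3 := supercritical ha q1 su fin.
have p0 : 0 < 3 * (q - 1) / 2 by lra.
have [M [M0 uM]] := solution_bounded ha p0 su fin.
have [C [C0 upper]] := solution_upper ha q1 su fin.
have [c [c0 lower]] := solution_lower ha hq su.
have [_ [_ [_ _ _ qfin]]] := solution_power_integrable ha q1 su fin.
have du : decaying a q u.
  split => //; first by exists M.
  move=> e e0; have [rho [_ H]] := solution_vanishes ha p0 su fin e0.
  by exists rho.
split.
- split.
    case=> [s| |//]; rewrite ?lte_fin => s3; (split; first exact: mL).
      rewrite normE; apply: (inv_pow_integrable_lt ha C0 s3 mu) => //.
      by move=> x; exact: ltW.
    apply: (@le_lt_trans _ _ M%:E); last exact: ltry.
    by apply: ess_sup_ler => x; rewrite lee_fin ger0_norm ?uM// ltW.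
  move=> s s0 s3 [_]; rewrite normE.
  exact: inv_pow_not_integrable ha c0 s0 s3 mu lower.
- exact: decaying_radial ha du.
pose K := C + 2 / c + 1.
have c2 : 0 < 2 / c by rewrite divr_gt0.
have K0 : 0 < K by rewrite /K; lra.
exists K; split; first by rewrite /K; lra.
exists 0 => x x0.
have xn : x != 0 by apply/eqP => x00; move: x0; rewrite x00 enorm0 ltxx.
rewrite bp_kernelE//; have at0 : 0 < a + enorm x by lra.
have k1 := kern_ge ha (ltW x0); have k2 := kern_le2 ha (ltW x0).
have kp := kern_gt0 (enorm x) ha.
split.
  apply: le_trans (lower x).
  rewrite mulrC ler_pdivrMr//; apply: le_trans k2 _.
  rewrite ler_pdivrMr// mulrAC mulfVK ?gt_eqF//.
  have -> : 2 = c * (2 / c) by field; rewrite gt_eqF.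
  by apply: ler_wpM2l; [exact: ltW|rewrite /K; lra].
apply: le_trans (upper x) _; apply: ler_pM; rewrite ?(ltW C0) ?invr_ge0 ?(ltW at0)//.
by rewrite /K; lra.
Qed.
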